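(* Consider the multi-agent system described in the context, whose communication digraph $\mathcal{G}$ contains a spanning tree and whose gain function $a$ satisfies the stated assumptions with some $\gamma\in(0.5,1)$. Then $\tilde{\varepsilon}(t)$ converges to zero in the $p$-th moment, i.e. $\lim_{t\to\infty}\mathbb{E}\|\tilde{\varepsilon}(t)\|^p=0$ for every $p\ge 2$; that is, $\lim_{t\to\infty}\mathbb{E}(x_j(t)-x_i(t))^p=0$ for all agents $i,j$ and all $p\ge 2$.
   Context: Graph: $N$ agents indexed by $\mathcal{V}=\{1,\dots,N\}$; a digraph $\mathcal{G}=(\mathcal{V},\mathcal{E})$ where $(j,i)\in\mathcal{E}$ means agent $i$ receives information from agent $j$. Weighted adjacency matrix $\mathcal{A}=[a_{ij}]$ with $a_{ii}=0$, $a_{ij}>0$ if $(j,i)\in\mathcal{E}$, $a_{ij}=0$ otherwise; in-neighbor set $\mathcal{N}_i=\{j\ne i:(j,i)\in\mathcal{E}\}$; Laplacian $\mathcal{L}=[l_{ij}]$ with $l_{ii}=\sum_{j\ne i}a_{ij}$, $l_{ij}=-a_{ij}$ ($i\neq j$). Since $\mathcal{G}$ contains a spanning tree, $0$ is a simple eigenvalue of $\mathcal{L}$ with right eigenvector $\mathbf{1}_N$ and a left eigenvector $r$ with $r^T\mathbf{1}_N=1$, and all other eigenvalues have positive real part. Gain: $a:[0,\infty)\to[0,\infty)$ is decreasing, bounded and piecewise continuous, and $\lim_{t\to\infty}t^{\gamma}a(t)$ exists and is positive, where $\gamma\in(0.5,1)$. Agents and protocol: agent $i$ has scalar state $x_i(t)\in\mathbb{R}$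 with $\dot x_i(t)=u_i(t)$. Agent $i$ has triggering instants $0=t_{0,i}<t_{1,i}<\cdots$, with $\tilde x_i(t)=x_i(t_{k,i})$ for $t\in[t_{k,i},t_{k+1,i})$, error $e_i(t)=\tilde x_i(t)-x_i(t)$, and $t_{k+1,i}=\inf\{t>t_{k,i}: e_i(t)^2\ge a(t)\}$. Agent $i$ receives from $j\in\mathcal{N}_i$ the signal $\tilde y_{ji}(t)=\tilde x_j(t)+\sigma_{ji}\eta_{ji}(t)$, where $\eta_{ji}$ ($i\in\mathcal{V}$, $j\in\mathcal{N}_i$) are mutually independent standard white noises independent of the initial states and $\sigma_{ji}>0$. The control is $u_i(t)=a(t)\sum_{j\in\mathcal{N}_i}a_{ij}(\tilde y_{ji}(t)-\tilde x_i(t))$. In Itô form, $dx_i(t)=-a(t)\sum_{j=1}^N l_{ij}(x_j(t)+e_j(t))\,dt+a(t)\sum_{j\in\mathcal{N}_i}a_{ij}\sigma_{ji}\,dw_{ji}(t)$, with $w_{ji}$ mutually independent standard one-dimensional Brownian motions. Disagreement: with $x=[x_1,\dots,x_N]^T$ and $J=\mathbf{1}_N r^T$, let $\delta(t)=(I_N-J)x(t)$. Let $T=[\mathbf{1}_N\ Y]$ be invertible with $T^{-1}=[r\ W^T]^T$, $Y\in\mathbb{C}^{N\times(N-1)}$, $W\in\mathbb{C}^{(N-1)\times N}$, such that $T^{-1}\mathcal{L}T=\mathrm{diag}(0,\tilde{\mathcal{L}})$ is the Jordan canonical form of $\mathcal{L}$. Define $\tilde{\varepsilon}(t)=W\delta(t)\in\mathbb{C}^{N-1}$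 (the last $N-1$ components of $T^{-1}\delta(t)$).
   Formalization: Added: the initial states x_i(0) have finite moments of every order (otherwise the p-th moments may be infinite for all t). The conclusion is stated as E|x_j(t)-x_i(t)|^p -> 0 for all i, j and real p>=2; the equivalent form for the transformed disagreement is not restated. *)

(* Defs.v *)
From HB Require Import structures.
From mathcomp Require Import all_boot all_order all_algebra.
From mathcomp Require Import all_classical all_reals all_analysis.
From mathcomp Require Import normal_distribution.
Set Implicit Arguments. Unset Strict Implicit. Unset Printing Implicit Defensive.
Import Order.TTheory GRing.Theory Num.Theory.
Import numFieldNormedType.Exports.
Local Open Scope classical_set_scope.
Local Open Scope ring_scope.

(* A i j = a_ij > 0  iff  (j,i) is an edge (i receives from j). *)
Definition is_adjacency {R : realType} (N : nat) (A : 'M[R]_N) : Prop :=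
  (forall i, A i i = 0) /\ (forall i j, 0 <= A i j).

Definition laplacian {R : realType} (N : nat) (A : 'M[R]_N) : 'M[R]_N :=
  \matrix_(i, j) (if i == j then \sum_(k < N | k != i) A i k else - A i j).

(* The digraph contains a (directed, rooted) spanning tree: a root r and a
   parent map par such that every non-root node i has the edge (par i, i) and
   following parents from any node reaches the root (no cycles). *)
Definition has_spanning_tree {R : realType} (N : nat) (A : 'M[R]_N) : Prop :=
  exists (r : 'I_N) (par : 'I_N -> 'I_N),
    (forall i, i != r -> 0 < A i (par i)) /\
    (forall i, exists k : nat, iter k par i = r).

Definition gain_assumptions {R : realType} (a : R -> R) (gamma : R) : Prop :=
  (forall t, 0 <= t -> 0 <= a t) /\
  (forall s t, 0 <= s -> s <= t -> a t <= a s) /\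
  (exists M, forall t, 0 <= t -> `|a t| <= M) /\
  (* piecewise continuous: finitely many discontinuities on every [0,T]
     (one-sided limits exist automatically by monotonicity) *)
  (forall T, exists S : seq R,
      forall t, 0 < t -> t <= T -> t \notin S -> {for t, continuous a}) /\
  (exists c : R, 0 < c /\ (t `^ gamma * a t) @[t --> +oo] --> c).

(* Mutually independent standard Brownian motions w j i (one per edge (j,i)),
   independent of the initial states x0.  Independence and Gaussianity are
   expressed jointly through finite-dimensional distributions: for every
   partition 0 <= s_0 < ... < s_m and measurable sets, the probability that
   the initial state vector lies in a measurable rectangle and all the
   increments lie in given measurable sets factorizes, each increment having
   law N(0, s_{k+1} - s_k) (normal_prob takes the standard deviation). *)
Definition brownian_family {d} {T : measurableType d} {R : realType}
  (P : probability T R) (N : nat) (A : 'M[R]_N)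
  (x0 : 'I_N -> T -> R) (w : 'I_N -> 'I_N -> R -> T -> R) : Prop :=
  (forall j i t, 0 < A i j -> measurable_fun setT (w j i t)) /\
  (forall j i, 0 < A i j -> {ae P, forall om, w j i 0 om = 0}) /\
  (forall j i, 0 < A i j ->
      {ae P, forall om, {within `[0, +oo[, continuous (fun t => w j i t om)}}) /\
  (forall (m : nat) (s : nat -> R), 0 <= s 0%N ->
     (forall k, (k < m)%N -> s k < s k.+1) ->
     forall (B : 'I_N -> set R) (C : 'I_N -> 'I_N -> nat -> set R),
     (forall i, measurable (B i)) -> (forall j i k, measurable (C j i k)) ->
     P [set om | (forall i, B i (x0 i om)) /\
                 (forall j i (k : nat), 0 < A i j -> (k < m)%N ->
                    C j i k (w j i (s k.+1) om - w j i (s k) om))]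
     = (P [set om | forall i, B i (x0 i om)] *
        \prod_(j < N) \prod_(i < N | (0 < A i j)%R) \prod_(k < m)
           normal_prob 0 (Num.sqrt (s k.+1 - s k)) (C j i k))%E).

Definition wiener_sum {T : Type} {R : realType} (f : R -> R) (W : R -> T -> R)
  (t : R) (n : nat) (om : T) : R :=
  \sum_(k < n) f (k%:R * t / n%:R) *
     (W (k.+1%:R * t / n%:R) om - W (k%:R * t / n%:R) om).

Definition is_wiener_integral {d} {T : measurableType d} {R : realType}
  (P : probability T R) (f : R -> R) (W : R -> T -> R) (t : R) (I : T -> R)
  : Prop :=
  measurable_fun setT I /\
  (fun n => (\int[P]_om ((I om - wiener_sum f W t n om) ^+ 2)%:E)%E) @ \oo --> 0%E.

(* triggering instants of a path y : t_0 = 0,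
   t_{k+1} = inf { t > t_k : (y(t_k) - y(t))^2 >= a(t) }   (+oo if empty) *)
Fixpoint trig_times {R : realType} (a : R -> R) (y : R -> R) (k : nat)
  : \bar R :=
  match k with
  | 0%N => 0%E
  | k'.+1 => match trig_times a y k' with
             | EFin r => ereal_inf
                 (EFin @` [set t | r < t /\ a t <= (y r - y t) ^+ 2])
             | _ => +oo%E
             end
  end.

Definition held_state {R : realType} (a : R -> R) (y z : R -> R) : Prop :=
  forall (k : nat) (r : R), trig_times a y k = r%:E ->
    forall t, r <= t -> (t%:E < trig_times a y k.+1)%E -> z t = y r.

(* Main.v *)
(* Let M be the noise integrated along the closed loop and fix a final time t.
   The path u |-> x u + (M t - M u) ends at x t and is driven by the drift only.
   Since L = (1 - Q) / h with Q stochastic and some power of Q contracting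
   (spanning tree), there is a seminorm nu, vanishing on constant vectors, with
   nu (v - b L v) <= (1 - lam b) nu v for all small b >= 0.  Hence, along a grid
   of [s, t], nu is dominated by iterated convex combinations of its value at s
   and of forcing terms sqrt (a s) + |M t - M u|; there is no Zeno behaviour, so
   the triggering error is at most sqrt a.  Convexity of y ^ 2m passes this
   bound to moments, and Fatou's lemma removes the grid.  Increments of M are
   L2-limits of Gaussian sums, so that
   E |M t - M u| ^ 2m <= C (a u ^ 2 (t - u)) ^ m.  Taking s = 0 bounds the
   moments polynomially in t; taking s = t / 2 then gives convergence, because
   a t ~ c t ^ (- gamma) makes exp (- lam a t t / 2) decay faster than any power
   and a (t / 2) ^ 2 t tend to 0. *)
Require Import Defs.
From HB Require Import structures.
From mathcomp Require Import all_boot all_order all_algebra.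
From mathcomp Require Import all_classical all_reals all_analysis.
From mathcomp Require Import normal_distribution measurable_realfun.
From mathcomp Require Import ring lra.
Import Order.TTheory GRing.Theory Num.Theory.
Import numFieldNormedType.Exports.
Local Open Scope classical_set_scope.
Local Open Scope ring_scope.
Set Implicit Arguments. Unset Strict Implicit. Unset Printing Implicit Defensive.

(** * A seminorm contracted by consensus steps *)

Section consensus_seminorm.
Context {R : realFieldType} {N : nat}.
Implicit Types (v : 'cV[R]_N) (S : 'M[R]_N).

(** Two features of the model dictate the shape. The closed-loop equation holds outside a null set
    that depends on the time, so a path can be used only at countably many times: hence grids. A
    Wiener integral up to [t] is given by sums on the uniform partitions of [[0, t]], and two of
    them share a partition only if the ratio of their end times is rational: hence grid points that
    are rational multiples of the final time. Adding the noise of [[u, t]] in advance makes a step a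
    deterministic contraction plus forcing; the price is a forcing that involves [M t - M u] for
    every grid time [u]. A supremum over [u] would require control of the whole noise path, whereas
    in a convex combination each [u] enters through its own moment. A single application from time 0
    cannot converge, since the forcing terms built on [a 0] do not vanish; it only supplies the a
    priori bound for the restart at [t / 2]. There [gamma < 1] lets [a t * t] grow like a power of
    [t], and [gamma > 1/2] kills the accumulated noise. Even integer exponents keep the estimates
    polynomial; a real [p] is recovered at the end. *)

Definition osc v : R :=
  \big[Num.max/0]_(p : 'I_N * 'I_N) (v p.1 0 - v p.2 0).

Definition spread v : R := \sum_i \sum_j `|v i 0 - v j 0|.

Definition stochastic S :=
  (forall i j, 0 <= S i j) /\ (forall i, \sum_j S i j = 1).

Lemma osc_ge0 v : 0 <= osc v.
Proof. exact: bigmax_ge_id. Qed.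

Lemma osc_ub v i j : v i 0 - v j 0 <= osc v.
Proof. exact: (le_bigmax _ (fun p : 'I_N * 'I_N => v p.1 0 - v p.2 0) (i, j)). Qed.

Lemma osc_le v c : 0 <= c -> (forall i j, v i 0 - v j 0 <= c) -> osc v <= c.
Proof. by move=> c0 vc; apply: bigmax_le => // -[i j] _; apply: vc. Qed.

Lemma oscD u v : osc (u + v) <= osc u + osc v.
Proof.
apply: osc_le => [|i j]; first by rewrite addr_ge0 ?osc_ge0.
rewrite !mxE opprD addrACA; exact: lerD (osc_ub _ _ _) (osc_ub _ _ _).
Qed.

Lemma oscZ c v : 0 <= c -> osc (c *: v) <= c * osc v.
Proof.
move=> c0; apply: osc_le => [|i j]; first by rewrite mulr_ge0 ?osc_ge0.
by rewrite !mxE -mulrBr ler_wpM2l// osc_ub.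
Qed.

Lemma spread_ge0 v : 0 <= spread v.
Proof. by apply: sumr_ge0 => i _; apply: sumr_ge0. Qed.

Lemma spread_ub v i j : `|v i 0 - v j 0| <= spread v.
Proof.
rewrite /spread (bigD1 i)//= (bigD1 j)//= -addrA lerDl addr_ge0//.
  by apply: sumr_ge0.
by apply: sumr_ge0 => k _; apply: sumr_ge0.
Qed.

Lemma osc_spread v : osc v <= spread v.
Proof.
apply: osc_le (spread_ge0 v) _ => i j.
exact: le_trans (ler_norm _) (spread_ub v i j).
Qed.

Lemma spread_le v c : (forall i j, v i 0 - v j 0 <= c) ->
  spread v <= N%:R ^+ 2 * c.
Proof.
move=> vc; have -> : N%:R ^+ 2 * c = \sum_(i < N) \sum_(j < N) c.
  by rewrite !sumr_const !card_ord -mulrnA -natrX mulr_natl mulnn.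
apply: ler_sum => i _; apply: ler_sum => j _.
by rewrite ler_norml vc andbT lerNl opprB vc.
Qed.

(** Doeblin minorization: rows sharing mass [eps] on one column differ only in their remaining mass
    [1 - eps]. *)
Lemma osc_contract S r eps v : stochastic S -> (forall i, eps <= S i r) ->
  0 <= eps <= 1 -> osc (S *m v) <= (1 - eps) * osc v.
Proof.
move=> [S0 S1] Sr /andP[e0 e1].
apply: osc_le => [|i j]; first by rewrite mulr_ge0 ?osc_ge0// subr_ge0.
rewrite !mxE.
(* couple the rows i and j so that both put mass eps on column r *)
pose E k : R := if k == r then eps else 0.
have sE : \sum_k E k = eps by rewrite -big_mkcond big_pred1_eq.
have SE i' k : 0 <= S i' k - E k.
  by rewrite /E; case: eqP => [->|]; rewrite ?subr0// subr_ge0.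
have sSE i' : \sum_k (S i' k - E k) = 1 - eps by rewrite sumrB S1 sE.
have row i' : \sum_k S i' k * v k 0 =
    \sum_k (S i' k - E k) * v k 0 + \sum_k E k * v k 0.
  by rewrite -big_split /=; apply: eq_bigr => k _; rewrite -mulrDl subrK.
rewrite !row opprD addrACA subrr addr0.
have [e1'|e1'] := eqVneq eps 1.
  have SE0 i' k : S i' k - E k = 0.
    have := sSE i'; rewrite e1' subrr => /eqP; rewrite psumr_eq0//.
    by move=> /allP/(_ k (mem_index_enum _))/implyP/(_ isT)/eqP.
  by rewrite !big1 ?subrr ?mulr_ge0 ?osc_ge0 ?subr_ge0// => k _; rewrite SE0 mul0r.
have d0 : 0 < 1 - eps by rewrite subr_gt0 lt_neqAle e1'.
(* After multiplication by [1 - eps], the mass of each residual row, both sides become double sums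
   against the product of the two residual rows. *)
rewrite -(ler_pM2l d0).
have -> : (1 - eps) * (\sum_k (S i k - E k) * v k 0 - \sum_k (S j k - E k) * v k 0)
  = \sum_k \sum_l (S i k - E k) * (S j l - E l) * (v k 0 - v l 0).
  under [RHS]eq_bigr => k _.
    under eq_bigr do rewrite mulrBr.
    rewrite sumrB; over.
  rewrite sumrB mulrBr; congr (_ - _).
    rewrite mulr_sumr; apply: eq_bigr => k _.
    by rewrite -mulr_suml -mulr_sumr sSE mulrA [_ * (1 - eps)]mulrC.
  rewrite exchange_big /= mulr_sumr; apply: eq_bigr => k _.
  by rewrite -mulr_suml -mulr_suml sSE mulrA.
have -> : (1 - eps) * ((1 - eps) * osc v)
  = \sum_k \sum_l (S i k - E k) * (S j l - E l) * osc v.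
  under eq_bigr do rewrite -mulr_suml -mulr_sumr sSE.
  by rewrite -mulr_suml -mulr_suml sSE mulrA.
apply: ler_sum => k _; apply: ler_sum => l _.
by rewrite ler_wpM2l ?mulr_ge0// osc_ub.
Qed.

Lemma stochasticM S S' : stochastic S -> stochastic S' -> stochastic (S *m S').
Proof.
move=> [S0 S1] [S'0 S'1]; split=> [i j|i].
  by rewrite mxE; apply: sumr_ge0 => k _; rewrite mulr_ge0.
under eq_bigr do rewrite mxE.
rewrite exchange_big /= -[RHS](S1 i); apply: eq_bigr => k _.
by rewrite -mulr_sumr S'1 mulr1.
Qed.

Lemma stochasticX S n : stochastic S -> stochastic (S ^+ n).
Proof.
move=> Ss; elim: n => [|n IH]; last by rewrite exprS; apply: stochasticM.
rewrite expr0; split=> [i j|i].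
  by rewrite mxE; case: (i == j).
rewrite (bigD1 i)//= mxE eqxx big1 ?addr0// => j ji.
by rewrite mxE eq_sym (negbTE ji).
Qed.

(** The parent path from [i] reaches [r] in [k] steps, each of weight at least [eta]; the loop at
    [r] pads it to length [n], so that one exponent serves all nodes. *)
Lemma root_column_ge S r (par : 'I_N -> 'I_N) eta n i k : stochastic S ->
  0 <= eta -> eta <= S r r -> (forall i, i != r -> eta <= S i (par i)) ->
  (k <= n)%N -> iter k par i = r -> eta ^+ n <= (S ^+ n) i r.
Proof.
move=> Ss e0 er ep; elim: n i k => [|n IH] i k.
  by rewrite leqn0 => /eqP -> /= ->; rewrite !expr0 mxE eqxx.
have step l : eta <= S i l -> eta ^+ n <= (S ^+ n) l r ->
    eta ^+ n.+1 <= (S ^+ n.+1) i r.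
  move=> e1 e2; rewrite exprS [in leRHS]exprS [leRHS]mxE (bigD1 l)//=.
  rewrite -[leLHS]addr0 lerD//; first by rewrite ler_pM// exprn_ge0.
  have [Sn0 _] := stochasticX n Ss.
  by apply: sumr_ge0 => ? _; rewrite mulr_ge0//; case: Ss.
have [ir|ir] := eqVneq i r.
  by move=> _ _; rewrite ir in step *; apply: (step r) => //; apply: (IH r 0%N).
case: k => [_ /= ir'|k kn]; first by rewrite ir' eqxx in ir.
by rewrite iterSr => kr; apply: (step (par i)); [exact: ep|exact: IH kr].
Qed.

Lemma osc_stochastic S v : stochastic S -> osc (S *m v) <= osc v.
Proof.
move=> Ss; apply: osc_le (osc_ge0 _) _ => i j.
have /(@osc_contract S i 0 v Ss) : forall i', 0 <= S i' i by case: Ss.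
rewrite lexx ler01 subr0 mul1r => /(_ isT); apply: le_trans; exact: osc_ub.
Qed.

Lemma bernoulli_ineq (x : R) n : 0 <= x <= 1 -> 1 - x *+ n <= (1 - x) ^+ n.
Proof.
move=> /andP[x0 x1]; elim: n => [|n IH]; first by rewrite mulr0n subr0 expr0.
rewrite exprS; apply: le_trans (ler_wpM2l _ IH); last by rewrite subr_ge0.
have : 0 <= x * (x *+ n) by rewrite mulr_ge0// mulrn_wge0.
rewrite mulrS; set y := x *+ n; lra.
Qed.

(* With rho^n0 the contraction factor of osc under Q^n0, the weighted sum of
   rho^-n * osc (Q^n v) over n < n0 is a seminorm contracted by Q itself,
   hence to first order in b by every convex combination 1 - b L of 1 and Q. *)
Lemma consensus_seminorm (A : 'M[R]_N) :
  (forall i, A i i = 0) -> (forall i j, 0 <= A i j) ->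
  (exists (r : 'I_N) (par : 'I_N -> 'I_N),
    (forall i, i != r -> 0 < A i (par i)) /\
    (forall i, exists k : nat, iter k par i = r)) ->
  forall L : 'M[R]_N,
  L = \matrix_(i, j) (if i == j then \sum_(k < N | k != i) A i k else - A i j) ->
  exists (nu : 'cV[R]_N -> R) (lam h K : R),
  [/\ 0 < lam, 0 < h, 0 < K & lam * h <= 1] /\
  [/\ forall v, 0 <= nu v,
      forall u v, nu (u + v) <= nu u + nu v,
      forall v, spread v <= K * nu v,
      forall v, nu v <= K * spread v &
      forall b v, 0 <= b <= h -> nu (v - b *: (L *m v)) <= (1 - lam * b) * nu v].
Proof.
move=> Ad A0 [r [par [Apar parr]]] L LE.
pose l := \sum_i \sum_k A i k.
have l0 : 0 <= l by apply: sumr_ge0 => i _; apply: sumr_ge0.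
(* [l] bounds every diagonal entry of [L], so this [h] leaves at least 1/2 on the diagonal of [Q],
   in particular on the loop at the root. *)
pose h : R := (2 * (l + 1))^-1.
have h0 : 0 < h by rewrite invr_gt0; lra.
pose Q : 'M[R]_N := 1%:M - h *: L.
have LD i : L i i <= l.
  rewrite LE mxE eqxx; apply: le_trans (_ : \sum_k A i k <= _).
    by rewrite big_mkcond /=; apply: ler_sum => k _; case: ifP.
  rewrite /l [leRHS](bigD1 i)//= lerDl.
  by apply: sumr_ge0 => j _; apply: sumr_ge0.
have QD i : 1 / 2 <= Q i i.
  rewrite !mxE eqxx.
  have : h * L i i <= h * l by rewrite ler_wpM2l// ltW.
  have : h * (2 * (l + 1)) = 1 by rewrite mulVf//; apply: lt0r_neq0; lra.
  set x := h * _; set y := h * L i i; move=> e1 e2.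
  have : x = 2 * (h * l) + 2 * h by rewrite /x; ring.
  have -> : (1 *+ true : R) = 1 by [].
  lra.
have QO i j : i != j -> Q i j = h * A i j.
  by move=> ij; rewrite !mxE (negbTE ij) sub0r LE mxE (negbTE ij) mulrN opprK.
have Qs : stochastic Q.
  split=> [i j|i].
    have [<-|ij] := eqVneq i j; first by apply: le_trans (QD i); lra.
    by rewrite QO// mulr_ge0// ltW.
  rewrite (bigD1 i)//= (eq_bigr (fun j => h * A i j)); last first.
    by move=> j ji; rewrite QO// eq_sym.
  rewrite -mulr_sumr !mxE eqxx LE mxE eqxx subrK//.
pose eta := \big[Num.min/1/2]_i (if i == r then 1/2 else Q i (par i)).
have eta0 : 0 < eta.
  rewrite /eta; elim/big_ind: _ => [|x y x0 y0|i _]; first lra.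
    by rewrite lt_min x0 y0.
  case: eqVneq => [_|ir]; first lra.
  have ip : i != par i by apply: contraNneq ir => ii; have := Apar i;
    rewrite -ii Ad ltxx; case: (eqVneq i r) => // _ /(_ isT).
  by rewrite QO// mulr_gt0// Apar.
have etar : eta <= Q r r.
  apply: le_trans (QD r); exact: bigmin_le_id.
have etap i : i != r -> eta <= Q i (par i).
  by move=> ir; rewrite /eta (bigD1 i)//= (negbTE ir) ge_min lexx.
have [kk kkP] : exists kk : 'I_N -> nat, forall i, iter (kk i) par i = r.
  by exists (fun i => sval (cid (parr i))) => i; case: cid.
(* The sum of the path lengths dominates each of them; the successor allows the division by [n0]
   below. *)
pose n0 := (\sum_i kk i)%N.+1.
have n0P i : eta ^+ n0 <= (Q ^+ n0) i r.
  apply: (root_column_ge (k := kk i) Qs (ltW eta0) etar etap) => //.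
  by rewrite /n0 (bigD1 i)//= -addnS leq_addr.
pose eps := eta ^+ n0.
have eta1 : eta <= 1.
  apply: le_trans etar _; case: Qs => Q0 /(_ r) <-.
  by rewrite (bigD1 r)//= lerDl sumr_ge0.
have eps0 : 0 < eps by rewrite exprn_gt0.
have eps1 : eps <= 1 by rewrite exprn_ile1// ltW.
have n0gt : (0 : R) < n0%:R by rewrite ltr0n.
(* Bernoulli's inequality gives [rho ^+ n0 >= 1 - eps / 2]; the halving keeps [rho] positive even
   when [eps / n0%:R] is 1. *)
pose rho := 1 - eps / n0%:R / 2.
have en0 : 0 < eps / n0%:R <= 1.
  by rewrite divr_gt0//= ler_pdivrMr// mul1r (le_trans eps1)// ler1n.
have rho0 : 0 < rho by rewrite /rho; move: en0 => /andP[]; lra.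
have rho1 : rho < 1 by rewrite /rho; move: en0 => /andP[]; lra.
have rhon : 1 - eps <= rho ^+ n0.
  apply: le_trans (bernoulli_ineq n0 _); last by move: en0 => /andP[? ?]; apply/andP; split; lra.
  have : eps / n0%:R * n0%:R = eps by rewrite divfK ?gt_eqF.
  rewrite -mulr_natr; set x := eps / _; lra.
pose nu v := \sum_(n < n0) rho ^- n * osc (Q ^+ n *m v).
have nu0 v : 0 <= nu v.
  by apply: sumr_ge0 => n _; rewrite mulr_ge0 ?osc_ge0// invr_ge0 exprn_ge0// ltW.
have rn n : 0 <= rho ^- n by rewrite invr_ge0 exprn_ge0// ltW.
have nuD u v : nu (u + v) <= nu u + nu v.
  rewrite -big_split /=; apply: ler_sum => n _; rewrite -mulrDr mulmxDr.
  by rewrite ler_wpM2l ?oscD.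
have nuZ c v : 0 <= c -> nu (c *: v) <= c * nu v.
  move=> c0; rewrite mulr_sumr; apply: ler_sum => n _; rewrite -scalemxAr.
  by rewrite mulrCA ler_wpM2l ?oscZ.
have nuQ v : nu (Q *m v) <= rho * nu v.
  have shift n : rho ^- n * osc (Q ^+ n *m (Q *m v)) =
      rho * (rho ^- n.+1 * osc (Q ^+ n.+1 *m v)).
    rewrite mulmxA (_ : Q ^+ n *m Q = Q ^+ n.+1); last by rewrite exprSr.
    by rewrite mulrA; congr (_ * _); rewrite exprS invfM mulrA mulfV ?mul1r// gt_eqF.
  rewrite /nu; under eq_bigr do rewrite shift.
  rewrite -mulr_sumr ler_wpM2l ?(ltW rho0)//.
  (* The shifted sum differs from [nu v] only at its ends: the new top term
     [rho ^- n0 * osc (Q ^+ n0 *m v)] is at most the lost bottom term [osc v]. *)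
  rewrite /n0 big_ord_recr [leRHS]big_ord_recl /= addrC.
  rewrite -/n0 lerD// expr0 invr1 mul1r expr0 mul1mx.
  apply: le_trans (_ : rho ^- n0 * ((1 - eps) * osc v) <= _).
    rewrite ler_wpM2l//; apply: (osc_contract (r := r)) => //.
      exact: stochasticX.
    by rewrite (ltW eps0).
  rewrite mulrA ler_piMl ?osc_ge0// mulrC ler_pdivrMr ?exprn_gt0// mul1r//.
pose K := 1 + N%:R ^+ 2 + \sum_(n < n0) rho ^- n.
have K0 : 0 <= \sum_(n < n0) rho ^- n by apply: sumr_ge0.
have N0 : 0 <= N%:R ^+ 2 :> R by rewrite exprn_ge0.
(* With [b = beta * h], the step [1 - b L] is [(1 - beta) + beta Q], contracted by
   [1 - beta (1 - rho)], that is [1 - lam b]. *)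
exists nu, ((1 - rho) / h), h, K; split; first split => //.
- by rewrite divr_gt0// subr_gt0.
- rewrite /K; lra.
- rewrite divfK ?gt_eqF//; lra.
split => //.
- move=> v; apply: le_trans (_ : N%:R ^+ 2 * nu v <= _); last first.
    by rewrite ler_wpM2r// /K; lra.
  apply: spread_le => i j; apply: le_trans (osc_ub _ _ _) _.
  rewrite /nu /n0 big_ord_recl /= expr0 invr1 mul1r expr0 mul1mx lerDl.
  by apply: sumr_ge0 => n _; rewrite mulr_ge0 ?osc_ge0.
- move=> v; apply: le_trans (_ : (\sum_(n < n0) rho ^- n) * spread v <= _).
    rewrite mulr_suml; apply: ler_sum => n _; rewrite ler_wpM2l//.
    apply: le_trans (osc_spread v); apply: osc_stochastic; exact: stochasticX.
  by rewrite ler_wpM2r ?spread_ge0// /K; lra.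
move=> b v /andP[b0 bh].
have -> : v - b *: (L *m v) = (1 - b / h) *: v + (b / h) *: (Q *m v).
  rewrite /Q mulmxBl mul1mx -scalemxAl scalerBr addrA -scalerDl subrK scale1r.
  by rewrite scalerA divfK ?gt_eqF.
have bh1 : b / h <= 1 by rewrite ler_pdivrMr// mul1r.
have bh0 : 0 <= b / h by rewrite divr_ge0// ltW.
apply: le_trans (nuD _ _) _.
have e1 : nu ((1 - b / h) *: v) <= (1 - b / h) * nu v by apply: nuZ; lra.
have e2 : nu ((b / h) *: (Q *m v)) <= (b / h) * (rho * nu v).
  by apply: le_trans (nuZ _ _ bh0) _; rewrite ler_wpM2l.
apply: le_trans (lerD e1 e2) _.
by rewrite le_eqVlt; apply/orP; left; apply/eqP; field; rewrite gt_eqF.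
Qed.

End consensus_seminorm.

(** * Triggering times of a continuous path *)

Section held_state.
Context {R : realType}.
Variables (a y z : R -> R).
Hypothesis a_gt0 : forall t, 0 <= t -> 0 < a t.
Hypothesis a_dec : forall s t, 0 <= s -> s <= t -> a t <= a s.
Hypothesis yc : {within `[0, +oo[, continuous y}.
Hypothesis yz : held_state a y z.

Lemma path_continuity t e : 0 <= t -> 0 < e ->
  exists2 d, 0 < d & forall s, 0 <= s -> `|s - t| < d -> `|y s - y t| < e.
Proof.
move=> t0 e0; move/subspace_continuousP : yc => /(_ t).
rewrite /= in_itv/= andbT => /(_ t0) /cvgrPdist_lt /(_ e e0).
rewrite near_withinE => -[d /= d0 dP]; exists d => // s s0 st.
by rewrite distrC dP//= ?in_itv/= ?andbT// distrC.
Qed.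

Lemma trig_times_ge0 k : (0 <= trig_times a y k)%E.
Proof.
elim: k => //= k; case: (trig_times a y k) => // r; rewrite lee_fin => r0.
by apply/ereal_infP => _ [t [rt _] <-]; rewrite lee_fin (le_trans r0)// ltW.
Qed.

(** Just after [r] the error is below [sqrt (a (r + 1))] by continuity, while the threshold on
    [[r, r + 1]] is at least [a (r + 1)]. *)
Lemma trig_times_lt k r : trig_times a y k = r%:E ->
  (r%:E < trig_times a y k.+1)%E.
Proof.
move=> kr; have r0 : 0 <= r by rewrite -lee_fin -kr trig_times_ge0.
rewrite /= kr.
have a1 : 0 < a (r + 1) by apply: a_gt0; lra.
have [|d d0 dP] := path_continuity r0 (e := Num.sqrt (a (r + 1))).
  by rewrite sqrtr_gt0.
have m0 : 0 < Num.min d 1 by rewrite lt_min d0 ltr01.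
apply: (@lt_le_trans _ _ (r + Num.min d 1)%:E); first by rewrite lte_fin; lra.
apply/ereal_infP => _ [t [rt at_] <-]; rewrite lee_fin leNgt; apply/negP => tr.
have : t < r + d by rewrite (lt_le_trans tr)// lerD2l ge_min lexx.
have : t < r + 1 by rewrite (lt_le_trans tr)// lerD2l ge_min lexx orbT.
move=> t1 td; have : `|y t - y r| < Num.sqrt (a (r + 1)).
  by apply: dP; rewrite ?gtr0_norm; lra.
rewrite -ltr_sqr ?nnegrE ?sqrtr_ge0// sqr_sqrtr ?ltW// real_normK ?num_real//.
rewrite -sqrrN opprB => yr.
have := a_dec (ltW (le_lt_trans r0 rt)) (ltW t1).
by rewrite leNgt (le_lt_trans at_ yr).
Qed.

(** Absence of Zeno behaviour. Otherwise all triggering times stay below [t] and accumulate at some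
    [ts <= t], where the path is continuous; yet each new trigger requires a move of at least
    [sqrt (a (t + 1))] at times near [ts]. *)
Lemma trig_times_cover t : 0 <= t -> exists k r,
  [/\ trig_times a y k = r%:E, r <= t & (t%:E < trig_times a y k.+1)%E].
Proof.
move=> t0; apply/not_existsP => H.
have fin k : exists2 r, trig_times a y k = r%:E & 0 <= r <= t.
  elim: k => [|k [r kr /andP[r0 rt]]]; first by exists 0; rewrite ?lexx.
  have := trig_times_lt kr; have : ~ (t%:E < trig_times a y k.+1)%E.
    by move=> tk; apply: (H k); exists r.
  move/negP; rewrite -leNgt; case: (trig_times a y k.+1) => // s.
  rewrite lee_fin lte_fin => st rs; exists s => //.
  by rewrite st (le_trans r0)// ltW.
have [rr rrP] : exists rr : nat -> R, forall k, trig_times a y k = (rr k)%:E /\ 0 <= rr k <= t.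
  exists (fun k => sval (cid2 (fin k))) => k; by case: cid2.
have rrt k : rr k <= t by have [_ /andP[]] := rrP k.
have rsup : has_sup (range rr) by split; [exists (rr 0%N), 0%N|exists t => _ [k _ <-]].
pose ts := sup (range rr).
have ts_ub k : rr k <= ts by apply: sup_upper_bound => //; exists k.
have ts0 : 0 <= ts by apply: le_trans (ts_ub 0%N); have [_ /andP[]] := rrP 0%N.
have ts_t : ts <= t by apply: ge_sup => [|_ [k _ <-]//]; exists (rr 0%N), 0%N.
have a1 : 0 < a (t + 1) by apply: a_gt0; lra.
pose e := Num.sqrt (a (t + 1)) / 2.
have e0 : 0 < e by rewrite divr_gt0// sqrtr_gt0.
have [d d0 dP] := path_continuity ts0 e0.
have [_ [k _ <-] kts] : exists2 x, range rr x & ts - d < x.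
  exact: sup_adherent.
(* The infimum need not be attained, as [a] may jump; a time [u] of the set just above it is used
   instead, kept below [t + 1] so that [a u >= a (t + 1)]. *)
have : (trig_times a y k.+1 < (Num.min (ts + d) (t + 1))%:E)%E.
  have [-> _] := rrP k.+1; rewrite lte_fin lt_min.
  by rewrite (le_lt_trans (ts_ub k.+1)) ?ltrDl//= (le_lt_trans (rrt k.+1))// ltrDl.
have [/= kr /andP[r0 _]] := rrP k; rewrite kr.
move=> /ereal_inf_lt[_ [u [ru au] <-]]; rewrite lte_fin lt_min => /andP[ud ut].
have u0 : 0 <= u by rewrite (le_trans r0)// ltW.
have h1 : `|y (rr k) - y ts| < e.
  by apply: dP => //; rewrite ltr_norml; move: (ts_ub k); lra.
have h2 : `|y u - y ts| < e by apply: dP => //; rewrite ltr_norml; lra.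
have : `|y (rr k) - y u| < Num.sqrt (a (t + 1)).
  rewrite ltr_norml; move: h1 h2; rewrite !ltr_norml /e; lra.
rewrite -ltr_sqr ?nnegrE ?sqrtr_ge0// sqr_sqrtr ?ltW// real_normK ?num_real//.
by rewrite ltNge => /negP; apply; apply: le_trans au; apply: a_dec => //; exact: ltW.
Qed.

Lemma held_state_sqr_le t : 0 <= t -> (z t - y t) ^+ 2 <= a t.
Proof.
move=> t0; have [k [r [kr rt tk]]] := trig_times_cover t0.
rewrite (yz kr rt tk).
(* The infimum ranges over times after [r] only; at [r] itself the error is 0. *)
have [->|tr] := eqVneq t r; first by rewrite subrr expr0n/= ltW// a_gt0// -lee_fin -kr trig_times_ge0.
rewrite leNgt; apply/negP => /ltW ay; move: tk; rewrite /= kr.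
apply/negP; rewrite -leNgt; apply: ereal_inf_lbound; exists t => //.
by split=> //; rewrite lt_neqAle eq_sym tr.
Qed.

(** Without Zeno behaviour the half-line is a countable union of holding intervals, and [z] is
    constant on each. *)
Lemma held_state_measurable : measurable_fun (`[0, +oo[%classic : set R) z.
Proof.
pose E k := [set t | match trig_times a y k with
  | EFin r => r <= t /\ (t%:E < trig_times a y k.+1)%E | _ => False end].
have mE k : measurable (E k).
  rewrite /E; case: (trig_times a y k) => [r||]; last 2 first.
  - by rewrite (_ : mkset _ = set0)//.
  - by rewrite (_ : mkset _ = set0)//.
  case: (trig_times a y k.+1) => [s||].
  - rewrite (_ : mkset _ = `[r, s[%classic)//; apply/seteqP; split=> t /=.
      by rewrite lte_fin in_itv/= => -[-> ->].
    by rewrite lte_fin in_itv/= => /andP[].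
  - rewrite (_ : mkset _ = `[r, +oo[%classic)//; apply/seteqP; split=> t /=.
      by rewrite in_itv/= andbT => -[-> _].
    by rewrite in_itv/= andbT => rt; rewrite ltry.
  - by rewrite (_ : mkset _ = set0)//; apply/seteqP; split=> t //= -[].
have -> : `[0, +oo[%classic = \bigcup_k E k.
  apply/seteqP; split=> t /=; rewrite in_itv/= andbT.
    by move=> /trig_times_cover[k [r [kr rt tk]]]; exists k => //; move: tk; rewrite /E /= kr.
  move=> [k _]; rewrite /E /=; have := trig_times_ge0 k.
  by case: (trig_times a y k) => // r; rewrite lee_fin => r0 [rt _]; apply: le_trans rt.
apply/measurable_fun_bigcup => // k.
have [[r kr]|nr] := pselect (exists r, trig_times a y k = r%:E).
  apply: (eq_measurable_fun (cst (y r))) => // t; rewrite inE /E /= kr => -[rt tk].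
  by rewrite (yz kr rt)//= kr.
rewrite (_ : E k = set0); first exact: measurable_fun_set0.
rewrite /E -subset0 => t /=; case Ek : (trig_times a y k) => [r||]// _.
by apply: nr; exists r.
Qed.

End held_state.

(** * Passing to the limit in moment bounds *)

Section fatou_bound.
Context {d} {T : measurableType d} {R : realType} (P : {measure set T -> \bar R}).
Local Open Scope ereal_scope.

Lemma limn_einf_ge (u : nat -> \bar R) l :
  (\forall n \near \oo, l <= u n) -> l <= limn_einf u.
Proof.
move=> [n _ nl]; rewrite limn_einf_lim; apply: lime_ge.
  exact: is_cvg_einfs.
exists n => // k /= nk; apply/ereal_infP => _ [j /= kj <-].
by apply: nl => /=; exact: leq_trans kj.
Qed.

(** The rank from which [f x <= g n x] holds may depend on [x]: each path chooses how fine a grid it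
    needs. *)
Lemma fatou_le (f : T -> \bar R) (g : nat -> T -> \bar R) (C : \bar R) :
  measurable_fun setT f -> (forall n, measurable_fun setT (g n)) ->
  (forall x, 0 <= f x) -> (forall n x, 0 <= g n x) ->
  {ae P, forall x, \forall n \near \oo, f x <= g n x} ->
  (\forall n \near \oo, \int[P]_x g n x <= C) -> \int[P]_x f x <= C.
Proof.
move=> mf mg f0 g0 fg [N _ gC].
have le1 : \int[P]_x f x <= \int[P]_x limn_einf (fun n => g n x).
  apply: ae_ge0_le_integral => //.
  - by move=> x _; apply: limn_einf_ge; apply: nearW => n.
  - rewrite (_ : (fun _ => _) = (fun x => - limn_esup (fun n => - g n x))).
      apply: measurableT_comp => //; apply: measurable_fun_limn_esup => n.
      exact: measurableT_comp.
    apply/funext => x; rewrite -limn_einfN; congr limn_einf.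
    by apply/funext => n /=; rewrite oppeK.
  - by apply: filterS fg => x fgx _; exact: limn_einf_ge.
apply: (le_trans le1); apply: (le_trans (fatou _ _ _ _)) => //.
rewrite limn_einf_lim; apply: lime_le; first exact: is_cvg_einfs.
exists N => // k /= Nk; apply: le_trans (gC k Nk).
by apply: ereal_inf_lbound; exists k => //=.
Qed.

Lemma cvge0_lt (u : nat -> \bar R) (e : R) : u @ \oo --> 0 -> (0 < e)%R ->
  \forall n \near \oo, u n < e%:E.
Proof.
move=> /fine_cvgP[ufin u0] e0; move/cvgr0_norm_lt : u0 => /(_ _ e0) /= ue.
near=> n; rewrite -[ltLHS]fineK; last by near: n.
by rewrite lte_fin (le_lt_trans (ler_norm _))//; near: n.
Unshelve. all: by end_near. Qed.

(* Along a subsequence with summable squared L2 distances the convergence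
   holds almost surely. *)
Lemma L2_limit_moment (X : T -> R) (S : nat -> T -> R) m C :
  measurable_fun setT X -> (forall n, measurable_fun setT (S n)) ->
  (fun n => \int[P]_x (((X x - S n x) ^+ 2)%:E)) @ \oo --> 0 ->
  (\forall n \near \oo, \int[P]_x ((S n x ^+ (2 * m))%:E) <= C%:E) ->
  \int[P]_x ((X x ^+ (2 * m))%:E) <= (2 ^+ (2 * m) * C)%:E.
Proof.
move=> mX mS XS [N0 _ SC].
have pick k : exists n, (N0 <= n)%N /\
    \int[P]_x (((X x - S n x) ^+ 2)%:E) <= ((1 / (2 ^ k.+1)%:R)%R)%:E.
  have e0 : (0 < 1 / (2 ^ k.+1)%:R :> R)%R by rewrite divr_gt0// ltr0n expn_gt0.
  have [N _ NP] : \forall n \near \oo,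
      \int[P]_x (((X x - S n x) ^+ 2)%:E) <= ((1 / (2 ^ k.+1)%:R)%R)%:E.
    by apply: filterS (cvge0_lt XS e0) => k' /ltW.
  exists (maxn N N0); split; first exact: leq_maxr.
  exact/NP/leq_maxl.
pose n k := sval (cid (pick k)).
have nN k : (N0 <= n k)%N by rewrite /n; case: cid => ? [].
have nP k : \int[P]_x (((X x - S (n k) x) ^+ 2)%:E) <= ((1 / (2 ^ k.+1)%:R)%R)%:E.
  by rewrite /n; case: cid => ? [].
pose D k x := ((X x - S (n k) x) ^+ 2)%R.
have mD k : measurable_fun setT (D k).
  by apply: measurable_funX; exact: measurable_funB.
have D0 k x : (0 <= D k x)%R by exact: sqr_ge0.
have ints : \int[P]_x (\sum_(k <oo) (D k x)%:E) < +oo.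
  rewrite integral_nneseries//; last 2 first.
    by move=> k; exact/measurable_EFinP.
    by move=> k x _; rewrite lee_fin.
  apply: (@le_lt_trans _ _ (\sum_(k <oo) ((1 / (2 ^ k.+1)%:R)%R)%:E)).
    apply: lee_nneseries => k *; last exact: nP.
    by apply: integral_ge0 => x _; rewrite lee_fin D0.
  by apply: le_lt_trans (epsilon_trick0 xpredT ler01) _; rewrite ltry.
have mDs : measurable_fun setT (fun x => \sum_(k <oo) (D k x)%:E).
  by apply: ge0_emeasurable_sum => [k x _ _|k _]; [rewrite lee_fin|exact/measurable_EFinP].
have Ds0 x : 0 <= \sum_(k <oo) (D k x)%:E by apply: nneseries_ge0 => k _ _; rewrite lee_fin.
have aeD : {ae P, forall x e, (0 < e)%R -> \forall k \near \oo, (D k x < e)%R}.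
  have /integrable_ae : P.-integrable setT (fun x => \sum_(k <oo) (D k x)%:E).
    apply/integrableP; split => //.
    by under eq_integral do rewrite gee0_abs//.
  move=> /(_ measurableT); apply: filterS => x /(_ Logic.I).
  rewrite ge0_fin_numE// => sx e e0.
  have D0' k : true -> 0 <= (D k x)%:E by rewrite lee_fin.
  have := @nneseries_tail_cvg R (fun k => (D k x)%:E) xpredT sx (fun k _ => D0' k isT).
  move=> /cvge0_lt/(_ e0); apply: filterS => k; rewrite -[(D k x < e)%R]lte_fin.
  apply: le_lt_trans; rewrite (nneseries_split _ 1); last by move=> *; rewrite lee_fin.
  by rewrite addn1 big_nat1 leeDl// nneseries_ge0 => // *; rewrite lee_fin.
(* Where [X x] is nonzero, [S (n k) x] is eventually within [|X x| / 2] of it, so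
   [|X x| <= 2 |S (n k) x|]; this is the origin of [2 ^+ (2 * m)]. *)
apply: (@fatou_le _ (fun k x => ((2 * S (n k) x) ^+ (2 * m))%:E)).
- by apply/measurable_EFinP; exact: measurable_funX.
- by move=> k; apply/measurable_EFinP; apply: measurable_funX; exact: measurable_funM.
- by move=> x; rewrite lee_fin exprM exprn_ge0// sqr_ge0.
- by move=> k x; rewrite lee_fin exprM exprn_ge0// sqr_ge0.
- apply: filterS aeD => x xD.
  have [x0|x0] := eqVneq (X x) 0%R.
    apply: nearW => k; rewrite x0 lee_fin.
    rewrite [leLHS]exprM expr0n/= exprM lerXn2r ?nnegrE ?sqr_ge0//.
  have e0 : (0 < (X x / 2) ^+ 2)%R.
    by rewrite exprn_even_gt0//= mulf_neq0// invr_neq0// pnatr_eq0.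
  move: (xD _ e0); apply: filterS => k; rewrite /D lee_fin => XS2.
  rewrite [leLHS]exprM [leRHS]exprM lerXn2r ?nnegrE ?sqr_ge0//.
  rewrite -[leLHS]real_normK ?num_real// -[leRHS]real_normK ?num_real//.
  rewrite lerXn2r ?nnegrE ?normr_ge0//.
  move: XS2; rewrite -[ltLHS]real_normK ?num_real// -[ltRHS]real_normK ?num_real//.
  rewrite ltr_pXn2r ?nnegrE ?normr_ge0// normrM [`|2^-1|%R]ger0_norm ?invr_ge0// => XS2.
  have := ler_normD (X x - S (n k) x)%R (S (n k) x).
  by rewrite subrK normrM [`|2|%R]ger0_norm//; lra.
- exists 0%N => // k _; rewrite EFinM.
  under eq_integral do rewrite exprMn EFinM.
  rewrite ge0_integralZl_EFin//; last 2 first.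
  + by move=> x _; rewrite lee_fin exprM exprn_ge0// sqr_ge0.
  + by apply/measurable_EFinP; exact: measurable_funX.
  by rewrite lee_pmul2l ?lte_fin ?exprn_gt0//; apply: SC; exact: nN.
Qed.

End fatou_bound.

(** * Moment generating functions of independent Gaussians *)

Section weighted_integral.
Local Open Scope ereal_scope.
Context {d d'} {X : measurableType d} {Z : measurableType d'} {R : realType}.
Variables (mu : {measure set X -> \bar R}) (h : X -> R) (Y : X -> Z).
Hypotheses (h0 : forall x, (0 <= h x)%R) (mh : measurable_fun setT h).
Hypothesis mY : measurable_fun setT Y.
Import HBNNSimple.

Lemma weighted_integral_nnsfun (f : {nnsfun Z >-> R}) :
  \int[mu]_x ((h x * f (Y x))%:E) = \sum_(r \in range f)
    r%:E * \int[mu]_x ((h x * \1_(f @^-1` [set r]) (Y x))%:E).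
Proof.
have m1 (r : R) : measurable_fun setT (fun x => \1_(f @^-1` [set r]) (Y x) : R).
  by apply: measurableT_comp => //; exact: measurable_indic.
transitivity (\int[mu]_x \sum_(r \in range f)
    (h x)%:E * (r * \1_(f @^-1` [set r]) (Y x))%:E).
  apply: eq_integral => x _; rewrite fimfunE EFinM -fsumEFin//.
  by rewrite ge0_mule_fsumr// => r; exact: nnfun_muleindic_ge0.
rewrite ge0_integral_fsum//; last 2 first.
- move=> r; apply/measurable_EFinP.
  by apply: measurable_funM => //; exact: measurable_funM.
- move=> r x _; apply: mule_ge0; first by rewrite lee_fin.
  exact: nnfun_muleindic_ge0.
apply: eq_fsbigr => r; rewrite inE => -[z _ <-].
rewrite -ge0_integralZl_EFin//.
- by apply: eq_integral => x _; rewrite -EFinM mulrCA.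
- by move=> x _; rewrite lee_fin mulr_ge0.
- by apply/measurable_EFinP; exact: measurable_funM.
Qed.

Lemma weighted_integral_lim (g : Z -> R) (mg : measurable_fun setT (EFin \o g)) :
  (forall z, (0 <= g z)%R) ->
  \int[mu]_x ((h x * g (Y x))%:E) = limn (fun n =>
    \int[mu]_x ((h x * nnsfun_approx measurableT mg n (Y x))%:E)).
Proof.
move=> g0; set f := nnsfun_approx _ _.
rewrite -monotone_convergence//.
- apply: eq_integral => x _; apply/esym/cvg_lim => //.
  under eq_fun do rewrite EFinM; rewrite EFinM; apply: cvgeZl => //.
  by apply: (cvg_nnsfun_approx measurableT mg) => // z _; rewrite lee_fin.
- move=> n; apply/measurable_EFinP; apply: measurable_funM => //.
  exact: measurableT_comp.
- by move=> n x _; rewrite lee_fin mulr_ge0.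
- move=> x _ m n mn; rewrite lee_fin ler_wpM2l//.
  exact/lefP/nd_nnsfun_approx.
Qed.

End weighted_integral.

Section eq_weighted_integral.
Import HBNNSimple.

(** Simple functions and monotone limits lead from indicators to nonnegative [g]. The weights carry
    the other factors of a product; the two sides are meant for the probability space and for the
    real line with a Gaussian density. *)
Lemma eq_weighted_integral d1 d2 d3 (X1 : measurableType d1)
  (X2 : measurableType d2) (Z : measurableType d3) (R : realType)
  (mu1 : {measure set X1 -> \bar R}) (mu2 : {measure set X2 -> \bar R})
  (h1 : X1 -> R) (h2 : X2 -> R) (Y1 : X1 -> Z) (Y2 : X2 -> Z) (g : Z -> R) :
  (forall x, 0 <= h1 x) -> measurable_fun setT h1 -> measurable_fun setT Y1 ->
  (forall x, 0 <= h2 x) -> measurable_fun setT h2 -> measurable_fun setT Y2 ->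
  (forall C, measurable C -> \int[mu1]_x ((h1 x * \1_C (Y1 x))%:E) =
     \int[mu2]_x ((h2 x * \1_C (Y2 x))%:E))%E ->
  measurable_fun setT g -> (forall z, 0 <= g z) ->
  (\int[mu1]_x ((h1 x * g (Y1 x))%:E) = \int[mu2]_x ((h2 x * g (Y2 x))%:E))%E.
Proof.
move=> h10 mh1 mY1 h20 mh2 mY2 h12 /measurable_EFinP mg g0.
rewrite (weighted_integral_lim mu1 h10 mh1 mY1 mg g0).
rewrite (weighted_integral_lim mu2 h20 mh2 mY2 mg g0).
congr (limn _); apply/funext => n.
rewrite !weighted_integral_nnsfun//; apply: eq_fsbigr => r _; rewrite h12//.
Qed.

End eq_weighted_integral.

(** Completing the square: the tilted density is a multiple of the normal density of mean
    [c * s ^+ 2]. *)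
Lemma normal_pdf_mgf (R : realType) (s c : R) : s != 0 ->
  (\int[lebesgue_measure]_x ((normal_pdf 0 s x * expR (c * x))%:E) =
   (expR (c ^+ 2 * s ^+ 2 / 2))%:E)%E.
Proof.
move=> s0.
have shift x : normal_pdf 0 s x * expR (c * x) =
    expR (c ^+ 2 * s ^+ 2 / 2) * normal_pdf (c * s ^+ 2) s x.
  rewrite /normal_pdf (negbTE s0) /normal_fun -[LHS]mulrA -expRD [RHS]mulrCA -expRD.
  by congr (_ * expR _); field.
under eq_integral do rewrite shift EFinM.
rewrite ge0_integralZl_EFin ?expR_ge0//.
- by rewrite integral_normal_pdf mule1.
- by move=> x _; rewrite lee_fin normal_pdf_ge0.
- by apply/measurable_EFinP; exact: measurable_normal_pdf.
Qed.

Section gaussian_family.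
Context {d} {T : measurableType d} {R : realType} (P : probability T R).
Variables (m : nat) (Y : nat -> T -> R) (s c : nat -> R).
Hypothesis mY : forall k, (k < m)%N -> measurable_fun setT (Y k).
Hypothesis s_neq0 : forall k, (k < m)%N -> s k != 0.
Hypothesis PY : forall C : nat -> set R, (forall k, measurable (C k)) ->
  P [set om | forall k, (k < m)%N -> C k (Y k om)] =
  (\prod_(k < m) normal_prob 0 (s k) (C k))%E.

(* The indicators of the factorization hypothesis are replaced by exponentials
   one at a time. *)
Lemma gaussian_mgf_prefix l (C : nat -> set R) : (l <= m)%N ->
  (forall k, measurable (C k)) ->
  (\int[P]_om ((\prod_(k < m)
     (if (k < l)%N then expR (c k * Y k om) else \1_(C k) (Y k om)))%:E) =
   (\prod_(k < m) (if (k < l)%N then expR (c k ^+ 2 * s k ^+ 2 / 2)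
                   else fine (normal_prob 0 (s k) (C k))))%:E)%E.
Proof.
elim: l C => [|l IH] C lm mC.
  rewrite (_ : (fun om => _) = EFin \o \1_[set om | forall k, (k < m)%N -> C k (Y k om)]).
    rewrite integral_indic//; last first.
      rewrite (_ : mkset _ = \bigcap_(k in [set k | (k < m)%N]) (Y k @^-1` C k)).
        apply: bigcap_measurableType => k /= km; rewrite -[X in measurable X]setTI.
        exact: mY.
      by apply/seteqP; split => om /= omk k /omk.
    rewrite setIT; transitivity (\prod_(k < m) normal_prob 0 (s k) (C k))%E; first exact: PY.
    rewrite (big_morph EFin EFinM (erefl 1%E)); apply: eq_bigr => k _.
    by rewrite fineK//; apply: fin_num_measure; exact: mC.
  apply/funext => om /=; rewrite indicE; congr EFin.
  case: (boolP (om \in _)) => [/set_mem|/negP] omC /=.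
    by rewrite big1// => k _; rewrite indicE mem_set//; exact: omC.
  apply/eqP/prodf_eq0; have /existsNP[k /not_implyP[km Ck]] :
      ~ (forall k, (k < m)%N -> C k (Y k om)) by move=> omC'; apply: omC; exact: mem_set.
  by exists (Ordinal km) => //=; rewrite indicE memNset.
pose L := Ordinal lm.
(* [h] gathers all factors but the one of index [l], and [q] their closed forms. *)
pose h om := \prod_(k < m | k != L)
  (if (k < l.+1)%N then expR (c k * Y k om) else \1_(C k) (Y k om)).
pose q := \prod_(k < m | k != L) (if (k < l.+1)%N then expR (c k ^+ 2 * s k ^+ 2 / 2)
                   else fine (normal_prob 0 (s k) (C k))).
have kl (k : 'I_m) : k != L -> (k < l.+1)%N = (k < l)%N.
  by move=> kL; rewrite ltnS leq_eqVlt; case: eqP => // kl; case/eqP: kL; apply: val_inj.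
have q0 : 0 <= q.
  by apply: prodr_ge0 => k _; case: ifP => _; rewrite ?expR_ge0 ?fine_ge0.
have mh : measurable_fun setT h.
  rewrite /h; under eq_fun do rewrite -big_filter.
  apply: measurable_prod => k _; case: (k < l.+1)%N.
    by apply: measurableT_comp => //; apply: measurable_funM => //; exact: mY.
  by apply: measurableT_comp; [exact: measurable_indic|exact: mY].
have h0 om : 0 <= h om.
  by apply: prodr_ge0 => k _; case: ifP => _; rewrite ?expR_ge0.
rewrite (bigD1 L)//= ltnSn -/q.
transitivity (\int[P]_om ((h om * expR (c l * Y l om))%:E))%E.
  by apply: eq_integral => om _; rewrite (bigD1 L)//= ltnSn -/(h om) mulrC.
rewrite (@eq_weighted_integral _ _ _ _ _ _ _ P lebesgue_measure h
  (fun x => q * normal_pdf 0 (s l) x) (Y l) id (fun x => expR (c l * x)))//.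
- under eq_integral do rewrite -mulrA EFinM.
  rewrite ge0_integralZl_EFin//.
  + by rewrite normal_pdf_mgf ?s_neq0// -EFinM mulrC.
  + by move=> x _; rewrite lee_fin mulr_ge0 ?expR_ge0 ?normal_pdf_ge0.
  + apply/measurable_EFinP; apply: measurable_funM; first exact: measurable_normal_pdf.
    by apply: measurableT_comp => //; exact: measurable_funM.
- exact: mY.
- by move=> x; rewrite mulr_ge0 ?normal_pdf_ge0.
- by apply: measurable_funM => //; exact: measurable_normal_pdf.
(* On the indicator of [D] the claim is the induction hypothesis with [C l] replaced by [D]. *)
- move=> D mD; have := IH (fun k => if k == l then D else C k) (ltnW lm).
  have mC' k : measurable (if k == l then D else C k) by case: ifP.
  move=> /(_ mC'); rewrite [in RHS](bigD1 L)//= ltnn eqxx => IHD.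
  transitivity ((fine (normal_prob 0 (s l) D) * q)%:E); last first.
    under eq_integral do rewrite -mulrA EFinM.
    rewrite ge0_integralZl_EFin//; last 2 first.
    + by move=> x _; rewrite lee_fin mulr_ge0 ?normal_pdf_ge0.
    + apply/measurable_EFinP; apply: measurable_funM; first exact: measurable_normal_pdf.
      exact: measurable_indic.
    rewrite EFinM fineK ?fin_num_measure// muleC; congr (_ * _)%E.
    rewrite /normal_prob [LHS]integral_mkcond; apply: eq_integral => x _.
    rewrite patchE indicE; case: ifP => _; rewrite ?mulr1 ?mulr0//.
  transitivity (\int[P]_om ((\prod_(k < m)
     (if (k < l)%N then expR (c k * Y k om)
      else \1_(if k == l :> nat then D else C k) (Y k om)))%:E))%E.
    apply: eq_integral => om _; rewrite [in RHS](bigD1 L)//= ltnn eqxx mulrC.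
    congr (_ * _)%:E; apply: eq_bigr => k kL; rewrite kl//.
    by case: ifP => //; rewrite (_ : (k == l :> nat) = false)//; apply: contraNF kL => /eqP kl'; apply/eqP/val_inj.
  rewrite IHD; congr (_ * _)%:E; apply: eq_bigr => k kL; rewrite kl//.
  by case: ifP => //; rewrite (_ : (k == l :> nat) = false)//; apply: contraNF kL => /eqP kl'; apply/eqP/val_inj.
- by apply: measurableT_comp => //; exact: measurable_funM.
Qed.

Lemma gaussian_mgf : (\int[P]_om ((expR (\sum_(k < m) c k * Y k om))%:E) =
  (expR ((\sum_(k < m) c k ^+ 2 * s k ^+ 2) / 2))%:E)%E.
Proof.
have := gaussian_mgf_prefix (leqnn m) (fun=> measurableT).
under eq_integral => om _.
  rewrite (eq_bigr (fun k : 'I_m => expR (c k * Y k om))); last by move=> k _; rewrite ltn_ord.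
  rewrite -expR_sum; over.
move=> ->; congr EFin; rewrite mulr_suml expR_sum.
by apply: eq_bigr => k _; rewrite ltn_ord.
Qed.

End gaussian_family.

(** * Moments of Wiener integral increments *)

(** One edge is isolated by taking [setT] for all other sets, which turns their factors into 1. *)
Lemma brownian_increments {d} {T : measurableType d} {R : realType}
  (P : probability T R) (N : nat) (A : 'M[R]_N) (x0 : 'I_N -> T -> R)
  (w : 'I_N -> 'I_N -> R -> T -> R) j0 i0 (m : nat) (s : nat -> R) :
  brownian_family P A x0 w -> 0 < A i0 j0 -> 0 <= s 0%N ->
  (forall k, (k < m)%N -> s k < s k.+1) ->
  forall C : nat -> set R, (forall k, measurable (C k)) ->
  P [set om | forall k, (k < m)%N ->
      C k (w j0 i0 (s k.+1) om - w j0 i0 (s k) om)] =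
  (\prod_(k < m) normal_prob 0 (Num.sqrt (s k.+1 - s k)) (C k))%E.
Proof.
move=> [_ [_ [_ H]]] A0 s0 sk C mC.
pose C' j i k := if (j == j0) && (i == i0) then C k else setT.
have mC' j i k : measurable (C' j i k) by rewrite /C'; case: ifP.
have := H m s s0 sk (fun=> setT) C' (fun=> measurableT) mC'.
rewrite (_ : [set om | _] = [set om | forall k, (k < m)%N ->
      C k (w j0 i0 (s k.+1) om - w j0 i0 (s k) om)]); last first.
  apply/seteqP; split=> om /=.
    by move=> [_ /(_ j0 i0)] + k km => /(_ k A0 km); rewrite /C' !eqxx.
  move=> CP; split=> // j i k _ km; rewrite /C'; case: ifP => // /andP[/eqP -> /eqP ->].
  exact: CP.
move=> ->; rewrite (_ : [set om | _] = setT); last by apply/seteqP; split.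
rewrite probability_setT mul1e (bigD1 j0)//= [X in (_ * X)%E]big1 ?mule1; last first.
  move=> j jj; rewrite big1// => i _; rewrite big1// => k _.
  by rewrite /C' (negbTE jj) probability_setT.
rewrite (bigD1 i0)//= [X in (_ * X)%E]big1 ?mule1; last first.
  move=> i /andP[_ ii]; rewrite big1// => k _.
  by rewrite /C' (negbTE ii) andbF probability_setT.
by apply: eq_bigr => k _; rewrite /C' !eqxx.
Qed.

Lemma exprn_le_expR {R : realType} (x : R) n : 0 <= x -> x ^+ n <= n`!%:R * expR x.
Proof.
move=> x0; case: n => [|n]; first by rewrite expr0 fact0 mul1r -expR0 ler_expR.
have f0 : 0 < n.+1`!%:R :> R by rewrite ltr0n fact_gt0.
have := expR_ge1Dxn n x0; rewrite -(ler_pM2l f0); apply: le_trans.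
by rewrite mulrDr mulr1 mulrCA mulfV ?gt_eqF// mulr1 lerDr ltW.
Qed.

Lemma even_exprn_le_cosh {R : realType} (x : R) n :
  x ^+ (2 * n) <= (2 * n)`!%:R * (expR x + expR (- x)).
Proof.
wlog x0 : x / 0 <= x.
  move=> H; have [|/ltW x0] := leP 0 x; first exact: H.
  have := H (- x); rewrite oppr_ge0 opprK => /(_ x0).
  by rewrite exprM sqrrN -exprM addrC.
apply: le_trans (exprn_le_expR _ x0) _.
by rewrite ler_wpM2l// lerDl expR_ge0.
Qed.

(** Comes from [x ^ 2n <= (2n)! (e^x + e^-x)] and from [e^(1/2)] as a bound on the mean of [e^X] and
    [e^-X] for a centred Gaussian [X] of variance at most 1. *)
Definition gaussian_const (R : realType) n : R :=
  (2 * n)`!%:R * (expR (1 / 2) + expR (1 / 2)).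

Section gaussian_moment.
Context {d} {T : measurableType d} {R : realType} (P : probability T R).
Variables (m : nat) (Y : nat -> T -> R) (s : nat -> R).
Hypothesis mY : forall k, (k < m)%N -> measurable_fun setT (Y k).
Hypothesis s_neq0 : forall k, (k < m)%N -> s k != 0.
Hypothesis PY : forall C : nat -> set R, (forall k, measurable (C k)) ->
  P [set om | forall k, (k < m)%N -> C k (Y k om)] =
  (\prod_(k < m) normal_prob 0 (s k) (C k))%E.

Lemma gaussian_moment (c : nat -> R) (V : R) n : 0 < V ->
  \sum_(k < m) c k ^+ 2 * s k ^+ 2 <= V ->
  (\int[P]_om (((\sum_(k < m) c k * Y k om) ^+ (2 * n))%:E) <=
   (gaussian_const R n * V ^+ n)%:E)%E.
Proof.
move=> V0 sV; set r := Num.sqrt V.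
have r0 : 0 < r by rewrite sqrtr_gt0.
have rV : r ^+ 2 = V by rewrite sqr_sqrtr// ltW.
pose X om := \sum_(k < m) c k * Y k om.
have mX : measurable_fun setT X.
  by apply: measurable_sum => k; apply: measurable_funM => //; exact: mY.
have mexp (b : R) : measurable_fun setT (fun om => expR (b * X om)).
  by apply: measurableT_comp => //; exact: measurable_funM.
(* Used with [b] equal to [1 / sqrt V] and its opposite, which rescale the sum to variance at most
   1. *)
have mgf (b : R) : b ^+ 2 * V = 1 ->
    (\int[P]_om ((expR (b * X om))%:E) <= (expR (1 / 2))%:E)%E.
  move=> bV; under eq_integral => om _.
    rewrite mulr_sumr (eq_bigr (fun k : 'I_m => (b * c k) * Y k om)); last first.
      by move=> k _; rewrite mulrA.
    over.
  rewrite /= (gaussian_mgf (fun k => b * c k) mY s_neq0 PY) lee_fin ler_expR.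
  rewrite ler_pM2r ?invr_gt0//.
  under eq_bigr do rewrite exprMn -mulrA.
  by rewrite -mulr_sumr -bV ler_wpM2l ?sqr_ge0.
apply: (@le_trans _ _ (\int[P]_om ((V ^+ n * (2 * n)`!%:R *
    (expR (r^-1 * X om) + expR (- r^-1 * X om)))%:E))%E).
  apply: ge0_le_integral => //.
  - by move=> om _; rewrite lee_fin exprM exprn_ge0// sqr_ge0.
  - by apply/measurable_EFinP; exact: measurable_funX.
  - by apply/measurable_EFinP; apply: measurable_funM => //; exact: measurable_funD.
  - move=> om _; rewrite lee_fin -/(X om) -mulrA mulNr.
    have := even_exprn_le_cosh (r^-1 * X om) n.
    have Vn0 : 0 < V ^+ n by rewrite exprn_gt0.
    move=> /(ler_wpM2l (ltW Vn0)); apply: le_trans.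
    by rewrite exprMn exprVn [r ^+ (2 * n)]exprM rV mulrA mulfV ?mul1r// gt_eqF.
under eq_integral do rewrite EFinM.
rewrite ge0_integralZl_EFin//; last 2 first.
- by apply/measurable_EFinP; exact: measurable_funD.
- by rewrite mulr_ge0// exprn_ge0// ltW.
rewrite mulrC /gaussian_const mulrAC [X in (_ <= X)%E]EFinM.
apply: lee_pmul => //.
  by rewrite lee_fin mulr_ge0// exprn_ge0// ltW.
  by apply: integral_ge0 => om _; rewrite lee_fin addr_ge0 ?expR_ge0.
under eq_integral do rewrite EFinD.
rewrite ge0_integralD//; last 2 first.
- by apply/measurable_EFinP.
- by apply/measurable_EFinP.
rewrite EFinD leeD// mgf// ?sqrrN exprVn rV mulVf ?gt_eqF//.
Qed.

End gaussian_moment.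

Lemma L2_cvgB {d} {T : measurableType d} {R : realType} (P : {measure set T -> \bar R})
  (X Y : T -> R) (Xn Yn : nat -> T -> R) :
  measurable_fun setT X -> measurable_fun setT Y ->
  (forall n, measurable_fun setT (Xn n)) -> (forall n, measurable_fun setT (Yn n)) ->
  (fun n => \int[P]_x (((X x - Xn n x) ^+ 2)%:E))%E @ \oo --> 0%E ->
  (fun n => \int[P]_x (((Y x - Yn n x) ^+ 2)%:E))%E @ \oo --> 0%E ->
  (fun n => \int[P]_x (((X x - Y x - (Xn n x - Yn n x)) ^+ 2)%:E))%E @ \oo --> 0%E.
Proof.
move=> mX mY mXn mYn cX cY.
have m2 (U : T -> R) (V : T -> R) : measurable_fun setT U -> measurable_fun setT V ->
    measurable_fun setT (fun x => ((U x - V x) ^+ 2)%:E).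
  by move=> mU mV; apply/measurable_EFinP; apply: measurable_funX; exact: measurable_funB.
(* From [(x - y)^2 <= 2 x^2 + 2 y^2]. *)
pose f n := (2%:E * \int[P]_x ((X x - Xn n x) ^+ 2)%:E +
             2%:E * \int[P]_x ((Y x - Yn n x) ^+ 2)%:E)%E.
apply: (@squeeze_cvge _ _ _ _ (cst 0%E) _ f).
- apply: nearW => n; rewrite integral_ge0/=; last by move=> x _; rewrite lee_fin sqr_ge0.
  rewrite /f -!ge0_integralZl_EFin ?ler0n//; try exact: m2;
    try by move=> x _; rewrite lee_fin sqr_ge0.
  rewrite -ge0_integralD//; last 4 first.
  + by move=> x _; rewrite mule_ge0// lee_fin sqr_ge0.
  + by apply: measurable_funeM; exact: m2.
  + by move=> x _; rewrite mule_ge0// lee_fin sqr_ge0.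
  + by apply: measurable_funeM; exact: m2.
  apply: ge0_le_integral => //.
  + by move=> x _; rewrite lee_fin sqr_ge0.
  + by apply: m2; exact: measurable_funB.
  + by apply: emeasurable_funD; apply: measurable_funeM; exact: m2.
  + move=> x _; rewrite -!EFinM -EFinD lee_fin.
    have := sqr_ge0 ((X x - Xn n x) + (Y x - Yn n x)); nra.
- exact: cvg_cst.
- rewrite /f -[X in _ --> X](_ : (2%:E * 0 + 2%:E * 0 = 0)%E); last by rewrite mule0 adde0.
  by apply: cvgeD => //; apply: cvgeZl.
Qed.

Lemma sum_ord_prefix {R : nmodType} (m n : nat) (F : nat -> R) : (m <= n)%N ->
  \sum_(k < m) F k = \sum_(k < n) (if (k < m)%N then F k else 0).
Proof. by move=> mn; rewrite (big_ord_widen n F mn) big_mkcond. Qed.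

Section wiener_increment.
Context {d} {T : measurableType d} {R : realType} (P : probability T R).
Variables (a : R -> R) (W : R -> T -> R).
Hypothesis a_ge0 : forall t, 0 <= t -> 0 <= a t.
Hypothesis a_dec : forall s t, 0 <= s -> s <= t -> a t <= a s.
Hypothesis mW : forall t, measurable_fun setT (W t).
Hypothesis PW : forall (m : nat) (s : nat -> R), 0 <= s 0%N ->
  (forall k, (k < m)%N -> s k < s k.+1) ->
  forall C : nat -> set R, (forall k, measurable (C k)) ->
  P [set om | forall k, (k < m)%N -> C k (W (s k.+1) om - W (s k) om)] =
  (\prod_(k < m) normal_prob 0 (Num.sqrt (s k.+1 - s k)) (C k))%E.

Lemma measurable_wiener_sum t n : measurable_fun setT (wiener_sum a W t n).
Proof.
apply: measurable_sum => k; apply: measurable_funM => //.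
exact: measurable_funB.
Qed.

(* The ratio of the two times being rational, both Wiener sums can be taken on
   a common partition. *)
Lemma wiener_sum_rational t p q n om : (0 < n)%N -> (p < q)%N ->
  wiener_sum a W t (n * q) om - wiener_sum a W (p%:R * t / q%:R) (n * p) om =
  \sum_(k < n * q) (if (k < n * p)%N then 0 else a (k%:R * t / (n * q)%:R)) *
    (W (k.+1%:R * t / (n * q)%:R) om - W (k%:R * t / (n * q)%:R) om).
Proof.
move=> n0 pq; pose F (k : nat) := a (k%:R * t / (n * q)%:R) *
    (W (k.+1%:R * t / (n * q)%:R) om - W (k%:R * t / (n * q)%:R) om).
have q0 : (0 < q)%N by exact: leq_ltn_trans pq.
have -> : wiener_sum a W (p%:R * t / q%:R) (n * p) om = \sum_(k < n * p) F k.
  apply: eq_bigr => k _; have p0 : (0 < p)%N.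
    by case: p k {pq} => // -[k]; rewrite muln0.
  have E (j : nat) : j%:R * (p%:R * t / q%:R) / (n * p)%:R = j%:R * t / (n * q)%:R.
    rewrite !natrM; field.
    by rewrite !pnatr_eq0 -!lt0n n0 p0 q0.
  by rewrite !E.
rewrite (sum_ord_prefix F (_ : n * p <= n * q)%N); last by rewrite leq_mul2l ltnW// orbT.
rewrite -sumrB; apply: eq_bigr => k _; rewrite /F.
by case: ifP => _; rewrite ?subrr ?mul0r// subr0.
Qed.

(** The approximating sums are Gaussian with weights [a] on the cells beyond [u], where [a] is at
    most [a u]; this bounds their variance by [a u ^+ 2] times the elapsed time, and the bound
    survives the L2 limit. *)
Lemma wiener_increment_moment t p q n It Iu : 0 < t -> (p < q)%N ->
  0 < a (p%:R * t / q%:R) ->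
  is_wiener_integral P a W t It ->
  is_wiener_integral P a W (p%:R * t / q%:R) Iu ->
  (\int[P]_om (((It om - Iu om) ^+ (2 * n))%:E) <=
   (2 ^+ (2 * n) * (gaussian_const R n *
     (a (p%:R * t / q%:R) ^+ 2 * (t - p%:R * t / q%:R)) ^+ n))%:E)%E.
Proof.
set u := p%:R * t / q%:R => t0 pq au [mIt cIt] [mIu cIu].
have q0 : (0 < q)%N by exact: leq_ltn_trans pq.
have qR : 0 < q%:R :> R by rewrite ltr0n.
(* The numbers of cells are in the ratio [u / t], so both partitions have the same mesh; the
   successor avoids empty partitions of [[0, t]]. *)
pose S l om := wiener_sum a W t (l.+1 * q) om - wiener_sum a W u (l.+1 * p) om.
have ut : u < t.
  by rewrite ltr_pdivrMr// mulrC ltr_pM2l// ltr_nat.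
have u0 : 0 <= u by rewrite !mulr_ge0// ?ltW// invr_gt0.
apply: (@L2_limit_moment _ _ _ _ _ S).
- exact: measurable_funB.
- by move=> l; apply: measurable_funB; exact: measurable_wiener_sum.
- apply: L2_cvgB => //; try by move=> l; exact: measurable_wiener_sum.
    have : (fun l => l.+1 * q)%N @ \oo --> \oo.
      by apply/cvgnyPge => B; exists B => // l /= Bl; rewrite (leq_trans Bl)// (leq_trans (leqnSn l))// leq_pmulr.
    by move=> /cvg_comp /(_ cIt).
  (* For [p = 0] the partitions of the second sum do not refine, but at time 0 every Wiener sum
     vanishes. *)
  have [p0|p0] := posnP p.
    rewrite (_ : (fun _ => _) = (fun l => \int[P]_x ((Iu x - wiener_sum a W u l x) ^+ 2)%:E)%E)//.
    apply/funext => l; apply: eq_integral => om _; congr ((_ - _) ^+ 2)%:E.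
    rewrite p0 muln0 /wiener_sum big_ord0 big1// => k _.
    by rewrite /u p0 !(mul0r,mulr0) subrr mulr0.
  have : (fun l => l.+1 * p)%N @ \oo --> \oo.
    by apply/cvgnyPge => B; exists B => // l /= Bl; rewrite (leq_trans Bl)// (leq_trans (leqnSn l))// leq_pmulr.
  by move=> /cvg_comp /(_ cIu).
apply: nearW => l; rewrite /S.
under eq_integral do rewrite wiener_sum_rational//.
pose M := (l.+1 * q)%N; have M0 : (0 < M)%N by rewrite muln_gt0.
have MR : 0 < M%:R :> R by rewrite ltr0n.
pose s (k : nat) : R := k%:R * t / M%:R.
have sD k : s k.+1 - s k = t / M%:R by rewrite /s -mulrBl -mulrBl -natr1 addrAC subrr add0r mul1r.
have sD0 : 0 < t / M%:R by rewrite divr_gt0.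
pose Y k om := W (s k.+1) om - W (s k) om.
pose c (k : nat) := if (k < l.+1 * p)%N then 0 else a (s k).
apply: (@gaussian_moment _ _ _ P M Y (fun k => Num.sqrt (s k.+1 - s k)) _ _ _ c).
- by move=> k _; exact: measurable_funB.
- by move=> k _; rewrite sD gt_eqF// sqrtr_gt0.
- move=> C mC; apply: PW => //; first by rewrite /s !mul0r.
  by move=> k _; rewrite -subr_gt0 sD.
- by rewrite mulr_gt0 ?exprn_gt0// subr_gt0.
have lpq : (l.+1 * p <= M)%N by rewrite leq_mul2l ltnW.
(* The variance bound is distributed over the cells so as to compare term by term; cells before [u]
   receive 0. *)
have -> : a u ^+ 2 * (t - u) = \sum_(k < M)
    (a u ^+ 2 * (t / M%:R) - (if (k < l.+1 * p)%N then a u ^+ 2 * (t / M%:R) else 0)).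
  rewrite sumrB -(sum_ord_prefix (fun=> a u ^+ 2 * (t / M%:R)))//.
  rewrite !sumr_const !card_ord -mulrnBr//.
  rewrite -[RHS]mulr_natr natrB// /u /M !natrM; field.
  by rewrite nat1r !pnatr_eq0 -lt0n q0.
apply: ler_sum => k _; rewrite sD sqr_sqrtr ?(ltW sD0)// /c.
case: ifPn => [_|]; first by rewrite expr0n/= mul0r subrr.
rewrite -leqNgt subr0 => pk; rewrite ler_wpM2r ?(ltW sD0)//.
have us : u <= s k.
  rewrite /u /s /M natrM ler_pdivlMr ?mulr_gt0 ?ltr0n// mulrA.
  rewrite [leLHS](_ : _ = (l.+1 * p)%:R * t); last first.
    by rewrite natrM; field; rewrite gt_eqF.
  by rewrite ler_pM2r// ler_nat.
by rewrite lerXn2r ?nnegrE ?a_ge0 ?a_dec// (le_trans u0).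
Qed.

End wiener_increment.

(** * The closed loop along one path *)

Section compact_path.
Context {R : realType}.
Variable y : R -> R.
Hypothesis yc : {within `[0, +oo[, continuous y}.

Lemma path_unif_continuous (T e : R) : 0 < e -> exists2 d, 0 < d &
  forall s t, 0 <= s -> 0 <= t <= T -> `|s - t| < d -> `|y s - y t| < e.
Proof.
move=> e0; have e20 : 0 < e / 2 by rewrite divr_gt0.
have [/(_ (@segment_compact _ 0 T)) cov _] := compact_near_coveringP (`[0, T]%classic : set R).
have := cov _ (0^'+) (fun d t => forall s, 0 <= s -> 0 <= t -> `|s - t| < d -> `|y s - y t| < e) _.
have H x : `[0, T]%classic x -> \forall x' \near x & d \near 0^'+,
    forall s, 0 <= s -> 0 <= x' -> `|s - x'| < d -> `|y s - y x'| < e.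
  rewrite /= in_itv/= => /andP[x0 _].
  have [d d0 dP] := path_continuity yc x0 e20.
  exists ((ball x (d / 2)), [set d' | 0 < d' /\ d' < d / 2]).
    split=> /=; first by apply: nbhsx_ballx; rewrite divr_gt0.
    apply: filterI; first exact: nbhs_right_gt.
    by apply: nbhs_right_lt; rewrite divr_gt0.
  move=> [x' d'] /= [xx' [d'0 d'd]] s s0 x'0 sx'.
  move: xx'; rewrite /ball/= => xx'.
  have h1 : `|y s - y x| < e / 2.
    by apply: dP => //; rewrite ltr_norml; move: sx' xx'; rewrite !ltr_norml; lra.
  have h2 : `|y x' - y x| < e / 2.
    by apply: dP => //; rewrite ltr_norml; move: sx' xx'; rewrite !ltr_norml; lra.
  by rewrite ltr_norml; move: h1 h2; rewrite !ltr_norml; lra.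
move=> /(_ _ H) [d /= d0 dP].
exists (d / 2); first by rewrite divr_gt0.
move=> s t s0 /andP[t0 tT]; have d20 : 0 < d / 2 by rewrite divr_gt0.
apply: (dP (d / 2)) => //=.
- by rewrite sub0r normrN gtr0_norm//; lra.
- by rewrite in_itv/= t0.
Qed.

Lemma path_bounded (T : R) : exists B, forall t, 0 <= t <= T -> `|y t| <= B.
Proof.
have [/(_ (@segment_compact _ 0 T)) cov _] := compact_near_coveringP (`[0, T]%classic : set R).
have := cov _ (+oo) (fun B t => 0 <= t -> `|y t| <= B) _.
have H x : `[0, T]%classic x -> \forall x' \near x & B \near +oo,
    0 <= x' -> `|y x'| <= B.
  rewrite /= in_itv/= => /andP[x0 _].
  have [d d0 dP] := path_continuity yc x0 ltr01.
  exists ((ball x d), [set B | `|y x| + 1 < B]).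
    split=> /=; first exact: nbhsx_ballx.
    exact: nbhs_pinfty_gt.
  move=> [x' B] /= [xx' yB] x'0.
  have h : `|y x' - y x| < 1 by apply: dP => //; rewrite distrC.
  have := ler_normD (y x' - y x) (y x); rewrite subrK; lra.
move=> /(_ _ H) [B /= [_ BP]].
exists (B + 1) => t tT; apply: (BP (B + 1)) => /=; rewrite ?ltrDl//.
by case/andP: tT.
Qed.

End compact_path.

Lemma spread_mulmx_le {R : realFieldType} {N : nat} (L : 'M[R]_N) (V : 'cV[R]_N) c :
  (forall j, `|V j 0| <= c) ->
  spread (L *m V) <= N%:R ^+ 2 * (2 * (\sum_i \sum_j `|L i j|) * c).
Proof.
move=> Vc; set S := \sum_i _.
have LV i : `|(L *m V) i 0| <= S * c.
  rewrite mxE; apply: le_trans (ler_norm_sum _ _ _) _.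
  apply: le_trans (_ : \sum_j `|L i j| * c <= _).
    by apply: ler_sum => j _; rewrite normrM ler_wpM2l.
  rewrite -mulr_suml ler_wpM2r//; last first.
    by rewrite /S [leRHS](bigD1 i)//= lerDl sumr_ge0// => k _; apply: sumr_ge0.
  exact: le_trans (Vc i).
apply: spread_le => i j; have := LV i; have := LV j.
by rewrite !ler_norml => /andP[? ?] /andP[? ?]; lra.
Qed.

(** The recursion of the grid bound with equality, kept as a function of the forcing sequence so
    that moments can be taken entry by entry. *)
Fixpoint convex_majorant {R : realFieldType} (th c : nat -> R) (z0 : R) k : R :=
  if k is k'.+1 then (1 - th k') * convex_majorant th c z0 k' + th k' * c k'
  else z0.

Section path_step.
Context {R : realType} {N : nat}.
Local Notation mu := (@lebesgue_measure R).
Variables (a : R -> R) (L : 'M[R]_N) (y z : 'I_N -> R -> R) (M : 'I_N -> R -> R).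
Hypothesis a_gt0 : forall t, 0 <= t -> 0 < a t.
Hypothesis a_dec : forall s t, 0 <= s -> s <= t -> a t <= a s.
Hypothesis yc : forall i, {within `[0, +oo[, continuous (y i)}.
Hypothesis yz : forall i, held_state a (y i) (z i).

Definition path_eqn t := forall i, (y i t)%:E =
  ((y i 0)%:E - \int[mu]_(s in `[0%R, t]%classic)
     (a s * \sum_(j < N) L i j * z j s)%:E + (M i t)%:E)%E.

Lemma gain_measurable T : measurable_fun (`[0, T]%classic : set R) a.
Proof.
(* [a] is monotone for nonnegative times only; [Num.max 0] extends it to a monotone function on the
   line. *)
apply: (eq_measurable_fun (fun t : R => a (Num.max 0 t) : R)).
  by move=> t; rewrite inE /= in_itv/= => /andP[t0 _]; rewrite max_r.
apply: nonincreasing_measurable => // s t st.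
apply: a_dec; first by rewrite le_max lexx.
by rewrite ge_max !le_max lexx/= st orbT.
Qed.

Lemma gain_integrable T : mu.-integrable `[0, T] (EFin \o a).
Proof.
apply: measurable_bounded_integrable => //.
- by rewrite /= lebesgue_measure_itv/=; case: ifP => _; rewrite ltry.
- exact: gain_measurable.
- exists (a 0); split; first by rewrite num_real.
  move=> B aB t /=; rewrite in_itv/= => /andP[t0 _].
  by rewrite ger0_norm ?(ltW (a_gt0 _))// (le_trans _ (ltW aB))// a_dec.
Qed.

Lemma held_integrable i T : mu.-integrable `[0, T] (fun s => (a s * z i s)%:E).
Proof.
apply: (@measurable_bounded_integrable _ _ _ mu (fun s => a s * z i s)) => //.
- by rewrite /= lebesgue_measure_itv/=; case: ifP => _; rewrite ltry.
- apply: measurable_funM; first exact: gain_measurable.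
  apply: measurable_funS (held_state_measurable a_gt0 a_dec (yc (i:=i)) (yz (i:=i))) => //.
  by move=> t /=; rewrite !in_itv/= andbT => /andP[].
have [B yB] := path_bounded (yc (i:=i)) T.
exists (a 0 * (B + Num.sqrt (a 0))); split; first by rewrite num_real.
move=> B' aB t /=; rewrite in_itv/= => /andP[t0 tT]; apply: le_trans (ltW aB).
rewrite normrM ger0_norm ?(ltW (a_gt0 _))//; apply: ler_pM => //.
- exact/ltW/a_gt0.
- exact: a_dec.
have := ler_normD (z i t - y i t) (y i t); rewrite subrK => /le_trans; apply.
rewrite addrC lerD ?yB ?t0//.
rewrite -(sqrtr_sqr (z i t - y i t)) ler_sqrt ?(ltW (a_gt0 _))//.
exact: le_trans (held_state_sqr_le a_gt0 a_dec (yc (i:=i)) (yz (i:=i)) t0) (a_dec _ _).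
Qed.

(** Only the equations at the two ends enter, which suits an equation valid almost surely at each
    fixed time. *)
Lemma path_increment s t : 0 <= s -> s <= t -> path_eqn s -> path_eqn t ->
  forall i, y i t - M i t = y i s - M i s -
    \sum_j L i j * \int[mu]_(v in `]s, t]) (a v * z j v).
Proof.
move=> s0 st es et i.
have eqn u : 0 <= u -> path_eqn u ->
    y i u - M i u = y i 0 - \sum_j L i j * \int[mu]_(v in `[0, u]) (a v * z j v).
  move=> u0 /(_ i); under eq_integral => v _.
    rewrite mulr_sumr (eq_bigr (fun j => L i j * (a v * z j v))); last first.
      by move=> j _; rewrite mulrCA.
    rewrite -sumEFin; over.
  rewrite integral_sum//; last first.
    move=> j; rewrite (_ : (fun x => _) = (fun x => (L i j)%:E * (a x * z j x)%:E)%E)//.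
    by apply: integrableZl => //; exact: held_integrable.
  under eq_bigr => j _.
    under eq_integral do rewrite EFinM.
    rewrite integralZl//; last exact: held_integrable.
    rewrite -[X in (_ * X)%E]fineK; last first.
      by apply: integrable_fin_num => //; exact: held_integrable.
    rewrite -EFinM; over.
  by rewrite sumEFin -EFinB -EFinD => -[->]; rewrite addrK.
rewrite (eqn t (le_trans s0 st) et) (eqn s s0 es) -addrA -opprD -big_split/=.
congr (_ - _); apply: eq_bigr => j _; rewrite -mulrDr; congr (_ * _).
rewrite -(@Rintegral_itvB _ _ (BLeft 0) (BRight t)) ?bnd_simp//; last exact: held_integrable.
by rewrite addrC subrK.
Qed.

Variables (nu : 'cV[R]_N -> R) (lam h K : R).
Hypothesis K_ge0 : 0 <= K.
Hypothesis nu_sub : forall u v, nu (u + v) <= nu u + nu v.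
Hypothesis nu_spread : forall v, nu v <= K * spread v.
Hypothesis nu_contract : forall b v, 0 <= b <= h ->
  nu (v - b *: (L *m v)) <= (1 - lam * b) * nu v.

Definition gain_integral s t : R := \int[mu]_(v in `]s, t]) a v.

(** The factor by which [nu (L *m V)] is controlled by a bound on the entries of [V]. *)
Definition drift_const := K * (N%:R ^+ 2 * (2 * (\sum_i \sum_j `|L i j|))).

Lemma sub_itv0 s t : 0 <= s -> (`]s, t] : set R) `<=` `[0, t].
Proof.
by move=> s0 v /=; rewrite !in_itv/= => /andP[sv ->]; rewrite (le_trans s0)// ltW.
Qed.

Lemma gain_integralP s t : 0 <= s -> s <= t ->
  a t * (t - s) <= gain_integral s t <= a s * (t - s).
Proof.
move=> s0 st; have int_a : mu.-integrable `]s, t] (EFin \o a).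
  by apply: integrableS (gain_integrable t) => //; exact: sub_itv0.
have int_c (c : R) : mu.-integrable `]s, t] (EFin \o cst c).
  apply: measurable_bounded_integrable => //.
    by rewrite /= lebesgue_measure_itv/=; case: ifP => _; rewrite ltry.
  by exists `|c|; split; rewrite ?num_real// => B cB v _ /=; exact: ltW.
have cE (c : R) : c * (t - s) = \int[mu]_(v in `]s, t]) cst c v.
  rewrite Rintegral_cst//=; congr (_ * _); rewrite lebesgue_measure_itv/= lte_fin.
  by case: ltgtP st => // ->; rewrite subrr.
rewrite !cE; apply/andP; split; apply: le_Rintegral => // v /=; rewrite in_itv/= => /andP[sv vt].
  by apply: a_dec => //; rewrite (le_trans s0)// ltW.
by apply: a_dec => //; exact: ltW.
Qed.

(* The noise of [u, Tf] is added in advance: only the drift moves this path, and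
   it ends at y Tf. *)
Definition shifted_path Tf u : 'cV[R]_N := \col_i (y i u + M i Tf - M i u).

(** An explicit Euler step of length [gain_integral s t], contracted by [nu], plus the effect of
    replacing the held values by the shifted path at [s]. They differ by the triggering error, the
    oscillation [e] within the step and the noise still to come. *)
Lemma path_step s t Tf e : 0 <= s -> s <= t -> path_eqn s -> path_eqn t ->
  a s * (t - s) <= h ->
  (forall i v, s <= v <= t -> `|y i v - y i s| <= e) ->
  nu (shifted_path Tf t) <= (1 - lam * gain_integral s t) * nu (shifted_path Tf s) +
    drift_const * (gain_integral s t *
      (Num.sqrt (a s) + e + \sum_j `|M j Tf - M j s|)).
Proof.
move=> s0 st es et ash ye.
have /andP[b1 b2] := gain_integralP s0 st.
set b := gain_integral s t in b1 b2 *; set eta := Num.sqrt (a s) + e + _.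
have b0 : 0 <= b by apply: le_trans b1; rewrite mulr_ge0 ?subr_ge0// ltW// a_gt0// (le_trans s0).
pose J : 'cV[R]_N := \col_j \int[mu]_(v in `]s, t]) (a v * z j v).
pose V := J - b *: shifted_path Tf s.
have int_z j : mu.-integrable `]s, t] (fun v => (a v * z j v)%:E).
  by apply: integrableS (held_integrable j t) => //; exact: sub_itv0.
have int_a : mu.-integrable `]s, t] (EFin \o a).
  by apply: integrableS (gain_integrable t) => //; exact: sub_itv0.
have Vle j : `|(- V) j 0| <= b * eta.
  rewrite !mxE normrN.
  set c := y j s + M j Tf - M j s.
  have int_c (c' : R) : mu.-integrable `]s, t] (fun v => (a v * c')%:E).
    rewrite (_ : (fun v => _) = (fun v => (EFin \o a) v * c'%:E)%E)//.
    exact: integrableZr.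
  have int_zc : mu.-integrable `]s, t] (EFin \o (fun v => a v * z j v - a v * c)).
    rewrite (_ : EFin \o _ = (fun v => (a v * z j v)%:E - (a v * c)%:E)%E)//.
    exact: integrableB.
  have -> : \int[mu]_(v in `]s, t]) (a v * z j v) - b * c =
      \int[mu]_(v in `]s, t]) (a v * z j v - a v * c).
    by rewrite (RintegralB _ (int_z j) (int_c c))// RintegralZr.
  apply: le_trans (le_normr_Rintegral _ _) _ => //.
  have -> : b * eta = \int[mu]_(v in `]s, t]) (a v * eta) by rewrite RintegralZr.
  apply: le_Rintegral => //; first exact: (integrable_abse int_zc).
    exact: (int_c eta).
  move=> v /=; rewrite in_itv/= => /andP[sv vt].
  have v0 : 0 <= v by rewrite (le_trans s0)// ltW.
  rewrite -mulrBr normrM ger0_norm ?(ltW (a_gt0 _))// ler_wpM2l ?(ltW (a_gt0 _))//.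
  have h1 : `|z j v - y j v| <= Num.sqrt (a s).
    rewrite -(sqrtr_sqr (z j v - y j v)) ler_sqrt ?(ltW (a_gt0 _))//.
    apply: le_trans (held_state_sqr_le a_gt0 a_dec (yc (i:=j)) (yz (i:=j)) v0) _.
    by apply: a_dec => //; exact: ltW.
  have h2 : `|y j v - y j s| <= e by apply: ye; rewrite (ltW sv).
  have h3 : `|M j Tf - M j s| <= \sum_j `|M j Tf - M j s|.
    by rewrite [leRHS](bigD1 j)//= lerDl sumr_ge0.
  have -> : z j v - c = (z j v - y j v) + (y j v - y j s) - (M j Tf - M j s).
    by rewrite /c; ring.
  apply: le_trans (ler_normB _ _) _; apply: lerD => //.
  by apply: le_trans (ler_normD _ _) _; exact: lerD.
have -> : shifted_path Tf t = (shifted_path Tf s - b *: (L *m shifted_path Tf s)) + L *m (- V).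
  rewrite mulmxN mulmxBr -scalemxAr opprB addrA subrK.
  apply/colP => i; rewrite !mxE.
  have := path_increment s0 st es et i.
  rewrite (eq_bigr (fun j => L i j * J j 0)); last by move=> j _; rewrite mxE.
  set Q := \sum_j _; move=> E.
  by rewrite -addrA [M i Tf - _]addrC addrA E; ring.
apply: le_trans (nu_sub _ _) _; apply: lerD; first by apply: nu_contract; rewrite b0 (le_trans b2).
apply: le_trans (nu_spread _) _; rewrite /drift_const -!mulrA ler_wpM2l//.
apply: le_trans (spread_mulmx_le L Vle) _.
by rewrite -!mulrA.
Qed.

Hypotheses (lam_gt0 : 0 < lam) (lamh : lam * h <= 1).

(** Dividing [drift_const] by [lam] writes the forcing of a step as [th k * c k], which completes
    the convex combination. The part due to [e] is a constant [x], preserved because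
    [(1 - th) x + th x = x], so it stays outside the majorant. *)
Lemma path_grid_bound (u : nat -> R) n Tf e z0 : 0 <= e -> 0 <= u 0%N ->
  (forall k, (k <= n)%N -> path_eqn (u k)) ->
  (forall k, (k < n)%N -> u k <= u k.+1) ->
  (forall k, (k < n)%N -> a (u 0%N) * (u k.+1 - u k) <= h) ->
  (forall i k v, (k < n)%N -> u k <= v <= u k.+1 -> `|y i v - y i (u k)| <= e) ->
  nu (shifted_path Tf (u 0%N)) <= z0 ->
  nu (shifted_path Tf (u n)) <=
  convex_majorant (fun k => lam * gain_integral (u k) (u k.+1))
    (fun k => drift_const / lam * (Num.sqrt (a (u 0%N)) + \sum_j `|M j Tf - M j (u k)|)) z0 n
  + drift_const / lam * e.
Proof.
move=> e0 u0 ueq uu uh ye uz.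
have u_ge k : (k <= n)%N -> u 0%N <= u k.
  by elim: k => // k IH kn; rewrite (le_trans (IH (ltnW kn)))// uu.
have D0 : 0 <= drift_const.
  rewrite /drift_const !mulr_ge0// sumr_ge0// => i _; exact: sumr_ge0.
have li0 : 0 <= lam^-1 by rewrite invr_ge0 ltW.
set th := fun k => _; set c := fun k => drift_const / lam * _.
suff H k : (k <= n)%N -> nu (shifted_path Tf (u k)) <=
    convex_majorant th c z0 k + drift_const / lam * e by exact: H.
elim: k => [_|k IH kn]; first by rewrite /= (le_trans uz)// lerDl (mulr_ge0 (mulr_ge0 D0 li0) e0).
have uk0 : 0 <= u k by rewrite (le_trans u0)// u_ge// ltnW.
have auk : a (u k) <= a (u 0%N) by apply: a_dec => //; rewrite u_ge// ltnW.
have ukk : 0 <= u k.+1 - u k by rewrite subr_ge0 uu.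
have := @path_step (u k) (u k.+1) Tf e uk0 (uu _ kn) (ueq _ (ltnW kn)) (ueq _ kn).
move=> /(_ (le_trans (ler_wpM2r ukk auk) (uh _ kn))) /(_ (fun i v => ye i k v kn)).
have /andP[b1 b2] := gain_integralP uk0 (uu _ kn).
move=> step; apply: (le_trans step).
have b0 : 0 <= gain_integral (u k) (u k.+1).
  by apply: le_trans b1; rewrite mulr_ge0// ltW// a_gt0// (le_trans u0)// u_ge.
have bh : gain_integral (u k) (u k.+1) <= h.
  by apply: (le_trans b2); apply: le_trans (uh _ kn); rewrite ler_wpM2r.
rewrite /= -/(th k).
have th1 : 0 <= 1 - th k.
  by rewrite subr_ge0 (le_trans _ lamh)// ler_wpM2l// ltW.
have h1 := ler_wpM2l th1 (IH (ltnW kn)).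
have h2 : Num.sqrt (a (u k)) <= Num.sqrt (a (u 0%N)) by rewrite ler_sqrt// ltW// a_gt0.
have -> : drift_const * (gain_integral (u k) (u k.+1) *
    (Num.sqrt (a (u k)) + e + \sum_j `|M j Tf - M j (u k)|)) =
    th k * (drift_const / lam * (Num.sqrt (a (u k)) + \sum_j `|M j Tf - M j (u k)|)) +
    th k * (drift_const / lam * e).
  by rewrite /th; field; rewrite gt_eqF.
have h3 : th k * (drift_const / lam * (Num.sqrt (a (u k)) + \sum_j `|M j Tf - M j (u k)|))
    <= th k * c k.
  rewrite ler_wpM2l ?mulr_ge0// ?(ltW lam_gt0)// ler_wpM2l ?divr_ge0// ?(ltW lam_gt0)//.
  by rewrite lerD2r.
apply: le_trans (lerD h1 (lerD h3 (lexx _))) _.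
rewrite le_eqVlt; apply/orP; left; apply/eqP; ring.
Qed.

End path_step.

(** * Moments of iterated convex combinations *)

Lemma convex_exprn {R : realDomainType} (th x y : R) q :
  0 <= th <= 1 -> 0 <= x -> 0 <= y ->
  ((1 - th) * x + th * y) ^+ q <= (1 - th) * x ^+ q + th * y ^+ q.
Proof.
move=> /andP[t0 t1] x0 y0; have t1' : 0 <= 1 - th by rewrite subr_ge0.
elim: q => [|q IH]; first by rewrite !expr0; lra.
have s0 : 0 <= (1 - th) * x + th * y by rewrite addr_ge0 ?mulr_ge0.
rewrite exprS; apply: (le_trans (ler_wpM2l s0 IH)).
rewrite [x ^+ q.+1]exprS [y ^+ q.+1]exprS.
(* The convexity gap left by the induction step is [th (1 - th)] times this product. *)
have mono : 0 <= (x - y) * (x ^+ q - y ^+ q).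
  have [xy|/ltW yx] := leP x y.
    by rewrite mulr_le0// subr_le0// lerXn2r.
  by rewrite mulr_ge0// subr_ge0// lerXn2r.
have : 0 <= th * (1 - th) * ((x - y) * (x ^+ q - y ^+ q)) by rewrite mulr_ge0// mulr_ge0.
set X := x ^+ q; set Y := y ^+ q; nra.
Qed.

Lemma exprnD_le {R : realDomainType} (x y : R) q : 0 <= x -> 0 <= y ->
  (x + y) ^+ q <= 2 ^+ q * (x ^+ q + y ^+ q).
Proof.
wlog xy : x y / x <= y.
  move=> H x0 y0; have [|/ltW yx] := leP x y; first by move=> xy; exact: H.
  by rewrite addrC [_ + y ^+ q]addrC; exact: H.
move=> x0 y0; apply: (@le_trans _ _ ((2 * y) ^+ q)).
  by rewrite lerXn2r ?nnegrE ?addr_ge0 ?mulr_ge0//; lra.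
by rewrite exprMn ler_wpM2l ?exprn_ge0// lerDr exprn_ge0.
Qed.

Definition moment {d} {T : measurableType d} {R : realType} (P : probability T R)
  (q : nat) (f : T -> R) : \bar R := (\int[P]_om ((f om ^+ q)%:E))%E.

Section moments.
Context {d} {T : measurableType d} {R : realType} (P : probability T R) (q : nat).
Implicit Types f g : T -> R.

Lemma moment_ge0 f : (forall om, 0 <= f om) -> (0 <= moment P q f)%E.
Proof. by move=> f0; apply: integral_ge0 => om _; rewrite lee_fin exprn_ge0. Qed.

Lemma le_moment f g : measurable_fun setT f -> measurable_fun setT g ->
  (forall om, 0 <= f om) -> (forall om, f om <= g om) ->
  (moment P q f <= moment P q g)%E.
Proof.
move=> mf mg f0 fg; apply: ge0_le_integral => //.
- by move=> om _; rewrite lee_fin exprn_ge0.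
- by apply/measurable_EFinP; exact: measurable_funX.
- by apply/measurable_EFinP; exact: measurable_funX.
- by move=> om _; rewrite lee_fin lerXn2r ?nnegrE// (le_trans (f0 om)).
Qed.

Lemma moment_cst c : moment P q (cst c) = (c ^+ q)%:E.
Proof.
rewrite /moment; transitivity (\int[P]_om (cst (c ^+ q)%:E om))%E => //.
by rewrite integral_cst//; transitivity ((c ^+ q)%:E * 1)%E; [congr (_ * _)%E; exact: probability_setT|rewrite mule1].
Qed.

Lemma momentZ_le c f C : 0 <= c -> measurable_fun setT f ->
  (forall om, 0 <= f om) -> (moment P q f <= C%:E)%E ->
  (moment P q (fun om => (c * f om)%R) <= (c ^+ q * C)%:E)%E.
Proof.
move=> c0 mf f0 fC; rewrite /moment.
under eq_integral do rewrite exprMn EFinM.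
rewrite ge0_integralZl_EFin ?exprn_ge0//.
- by rewrite EFinM lee_wpmul2l// lee_fin exprn_ge0.
- by move=> om _; rewrite lee_fin exprn_ge0.
- by apply/measurable_EFinP; exact: measurable_funX.
Qed.

Lemma momentD_le f g C D : measurable_fun setT f -> measurable_fun setT g ->
  (forall om, 0 <= f om) -> (forall om, 0 <= g om) ->
  (moment P q f <= C%:E)%E -> (moment P q g <= D%:E)%E ->
  (moment P q (fun om => (f om + g om)%R) <= (2 ^+ q * (C + D))%:E)%E.
Proof.
move=> mf mg f0 g0 fC gD.
have mfq : measurable_fun setT (fun om => (f om ^+ q)%:E).
  by apply/measurable_EFinP; exact: measurable_funX.
have mgq : measurable_fun setT (fun om => (g om ^+ q)%:E).
  by apply/measurable_EFinP; exact: measurable_funX.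
apply: (@le_trans _ _ (\int[P]_om ((2 ^+ q)%:E * ((f om ^+ q)%:E + (g om ^+ q)%:E)))%E).
  apply: ge0_le_integral => //.
  - by move=> om _; rewrite lee_fin exprn_ge0// addr_ge0.
  - by apply/measurable_EFinP; apply: measurable_funX; exact: measurable_funD.
  - by apply: measurable_funeM; exact: emeasurable_funD.
  - by move=> om _; rewrite -EFinD -EFinM lee_fin exprnD_le.
rewrite ge0_integralZl_EFin ?exprn_ge0//; last 2 first.
- by move=> om _; rewrite adde_ge0// lee_fin exprn_ge0.
- exact: emeasurable_funD.
rewrite EFinM lee_wpmul2l ?lee_fin ?exprn_ge0//.
rewrite ge0_integralD//; last 2 first.
- by move=> om _; rewrite lee_fin exprn_ge0.
- by move=> om _; rewrite lee_fin exprn_ge0.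
by rewrite EFinD leeD.
Qed.

Lemma moment_sum_le (I : Type) (s : seq I) (X : I -> T -> R) (C : I -> R) :
  (0 < q)%N -> (forall i, measurable_fun setT (X i)) ->
  (forall i om, 0 <= X i om) -> (forall i, 0 <= C i) ->
  (forall i, moment P q (X i) <= (C i)%:E)%E ->
  (moment P q (fun om => (\sum_(i <- s) X i om)%R) <=
   (2 ^+ (q * size s) * \sum_(i <- s) C i)%:E)%E.
Proof.
move=> q0 mX X0 C0 XC; elim: s => [|i s IH].
  under [X in moment _ _ X]eq_fun do rewrite big_nil.
  by rewrite (moment_cst 0) expr0n gtn_eqF// big_nil mulr0.
under [X in moment _ _ X]eq_fun do rewrite big_cons.
apply: (le_trans (momentD_le _ _ _ _ (XC i) IH)) => //.
- exact: measurable_sum.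
- by move=> om; apply: sumr_ge0.
rewrite lee_fin big_cons /= mulnS exprD -mulrA ler_wpM2l ?exprn_ge0//.
rewrite mulrDr lerD2r ler_peMl// exprn_ege1//; lra.
Qed.

(** By convexity the moments obey the recursion of the majorant itself, each [c k] entering through
    its own moment. [B] is a fixed point of that recursion, and the initial moment shrinks by
    [1 - r] per step. *)
Lemma convex_majorant_moment (th : nat -> R) (c : nat -> T -> R) (z0 : T -> R)
  n r C0 B : 0 <= r <= 1 -> 0 <= C0 -> 0 <= B ->
  (forall k, (k < n)%N -> r <= th k <= 1) ->
  (forall k, (k < n)%N -> measurable_fun setT (c k)) ->
  (forall k om, 0 <= c k om) -> measurable_fun setT z0 -> (forall om, 0 <= z0 om) ->
  (moment P q z0 <= C0%:E)%E ->
  (forall k, (k < n)%N -> (moment P q (c k) <= B%:E)%E) ->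
  let Z om := convex_majorant th (c^~ om) (z0 om) n in
  [/\ measurable_fun setT Z, forall om, 0 <= Z om &
      (moment P q Z <= ((1 - r) ^+ n * C0 + B)%:E)%E].
Proof.
move=> /andP[r0 r1] C00 B0; elim: n => [|n IH] thr mc c0 mz0 z00 zC cB /=.
  by split=> //; rewrite expr0 mul1r (le_trans zC)// lee_fin lerDl.
have [] := IH (fun k kn => thr k (ltnW kn)) (fun k kn => mc k (ltnW kn)) c0 mz0 z00 zC
  (fun k kn => cB k (ltnW kn)).
set Z := fun om => convex_majorant _ _ _ n => mZ Z0 ZB.
have /andP[thr0 thr1] := thr n (leqnn _).
have th0 : 0 <= th n by rewrite (le_trans r0).
have th1 : 0 <= 1 - th n by rewrite subr_ge0.
have mcn := mc n (leqnn _).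
split.
- by apply: measurable_funD; apply: measurable_funM.
- by move=> om; rewrite addr_ge0 ?mulr_ge0//; exact: Z0.
have mZq : measurable_fun setT (fun om => (Z om ^+ q)%:E).
  by apply/measurable_EFinP; exact: measurable_funX.
have mcq : measurable_fun setT (fun om => (c n om ^+ q)%:E).
  by apply/measurable_EFinP; exact: measurable_funX.
apply: (@le_trans _ _ (\int[P]_om ((1 - th n)%:E * (Z om ^+ q)%:E +
    (th n)%:E * (c n om ^+ q)%:E))%E).
  apply: ge0_le_integral => //.
  - by move=> om _; rewrite lee_fin exprn_ge0// addr_ge0 ?mulr_ge0//; exact: Z0.
  - by apply/measurable_EFinP; apply: measurable_funX; apply: measurable_funD; apply: measurable_funM.
  - by apply: emeasurable_funD; apply: measurable_funeM.
  - move=> om _; rewrite -!EFinM -EFinD lee_fin; apply: convex_exprn => //.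
    by rewrite th0.
rewrite ge0_integralD//; last 4 first.
- by move=> om _; rewrite mule_ge0 ?lee_fin ?exprn_ge0//; exact: Z0.
- exact: measurable_funeM.
- by move=> om _; rewrite mule_ge0 ?lee_fin ?exprn_ge0//; exact: Z0.
- exact: measurable_funeM.
rewrite !ge0_integralZl_EFin//; last 2 first.
- by move=> om _; rewrite lee_fin exprn_ge0//; exact: Z0.
- by move=> om _; rewrite lee_fin exprn_ge0//; exact: Z0.
apply: (@le_trans _ _ ((1 - th n)%:E * ((1 - r) ^+ n * C0 + B)%:E + (th n)%:E * B%:E)%E).
  by apply: leeD; apply: lee_wpmul2l; rewrite ?lee_fin//; exact: cB.
rewrite -!EFinM -EFinD lee_fin exprS mulrDr -addrA -mulrDl subrK mul1r lerD2r.
by rewrite mulrA ler_wpM2r// ler_wpM2r ?exprn_ge0 ?subr_ge0// lerD2l lerN2.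
Qed.

End moments.

(** * Moments of the disagreement *)

Lemma spreadD {R : realFieldType} {N : nat} (u v : 'cV[R]_N) :
  spread (u + v) <= spread u + spread v.
Proof.
rewrite /spread -big_split; apply: ler_sum => i _.
rewrite -big_split; apply: ler_sum => j _ /=.
by rewrite !mxE opprD addrACA ler_normD.
Qed.

Section closed_loop.
Context {d} {T : measurableType d} {R : realType} (P : probability T R) {N : nat}.
Variables (A : 'M[R]_N) (sigma : 'I_N -> 'I_N -> R) (a : R -> R).
Variables (w : 'I_N -> 'I_N -> R -> T -> R) (x xt : 'I_N -> R -> T -> R).
Variable I : 'I_N -> 'I_N -> R -> T -> R.
Hypothesis adjA : is_adjacency A.
Hypothesis treeA : has_spanning_tree A.
Hypothesis a_gt0 : forall t, 0 <= t -> 0 < a t.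
Hypothesis a_dec : forall s t, 0 <= s -> s <= t -> a t <= a s.
Hypothesis bw : brownian_family P A (fun i => x i 0) w.
Hypothesis mx : forall i t, measurable_fun setT (x i t).
Hypothesis cx : forall i,
  {ae P, forall om, {within `[0, +oo[, continuous (fun t => x i t om)}}.
Hypothesis hx : forall i om, held_state a (fun t => x i t om) (fun t => xt i t om).
Hypothesis hI : forall j i t, 0 < A i j -> 0 <= t -> is_wiener_integral P a (w j i) t (I j i t).

Definition edge_noise (i : 'I_N) t om : R :=
  \sum_(j < N | 0 < A i j) A i j * sigma j i * I j i t om.

Hypothesis ito : forall t, 0 <= t -> {ae P, forall om,
  path_eqn a (laplacian A) (fun i t => x i t om) (fun i t => xt i t om)
    (fun i t => edge_noise i t om) t}.

Definition noise_increment t u om : R := \sum_i `|edge_noise i t om - edge_noise i u om|.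

Definition disagreement t om : R := spread (\col_i x i t om).

Lemma measurable_edge_noise i t : 0 <= t -> measurable_fun setT (edge_noise i t).
Proof.
move=> t0; rewrite (_ : edge_noise i t = fun om =>
    \sum_(j < N) (if 0 < A i j then A i j * sigma j i * I j i t om else 0)).
  apply: measurable_sum => j; have [Aij|_] := boolP (0 < A i j) => //.
  by apply: measurable_funM => //; have [] := hI Aij t0.
by apply/funext => om; rewrite /edge_noise big_mkcond.
Qed.

Lemma measurable_noise_increment t u : 0 <= t -> 0 <= u ->
  measurable_fun setT (noise_increment t u).
Proof.
move=> t0 u0; apply: measurable_sum => i; apply: measurableT_comp => //.
by apply: measurable_funB; exact: measurable_edge_noise.
Qed.

Lemma noise_increment_ge0 t u om : 0 <= noise_increment t u om.
Proof. by apply: sumr_ge0. Qed.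

Lemma measurable_disagreement t : measurable_fun setT (disagreement t).
Proof.
rewrite (_ : disagreement t = fun om => \sum_i \sum_j `|x i t om - x j t om|).
  apply: measurable_sum => i; apply: measurable_sum => j.
  by apply: measurableT_comp => //; exact: measurable_funB.
apply/funext => om; apply: eq_bigr => i _; apply: eq_bigr => j _.
by rewrite !mxE.
Qed.

(** The edges are added by the crude inequality of [moment_sum_le], so [C] depends on the weights,
    the noise intensities and [m], but on no time. *)
Lemma noise_increment_moment m : (0 < m)%N -> exists2 C, 0 <= C &
  forall t p q, 0 < t -> (p < q)%N -> let u := p%:R * t / q%:R in
  (moment P (2 * m) (noise_increment t u) <= (C * (a u ^+ 2 * (t - u)) ^+ m)%:E)%E.
Proof.
move=> m0.
pose Ce (e : 'I_N * 'I_N) : R := if 0 < A e.1 e.2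
  then `|A e.1 e.2 * sigma e.2 e.1| ^+ (2 * m) * (2 ^+ (2 * m) * gaussian_const R m) else 0.
have Ce0 e : 0 <= Ce e.
  rewrite /Ce; case: ifP => // _; rewrite mulr_ge0 ?exprn_ge0//.
  by rewrite mulr_ge0 ?exprn_ge0// /gaussian_const mulr_ge0// addr_ge0 ?expR_ge0.
pose s := index_enum ('I_N * 'I_N)%type.
exists (2 ^+ ((2 * m) * size s) * \sum_(e <- s) Ce e).
  by rewrite mulr_ge0 ?exprn_ge0// sumr_ge0.
move=> t p q t0 pq /=; set u := p%:R * t / q%:R; have q0 : (0 < q)%N by exact: leq_ltn_trans pq.
have u0 : 0 <= u by rewrite !mulr_ge0// ?ltW// invr_gt0 ltr0n.
have ut : u < t by rewrite ltr_pdivrMr ?ltr0n// mulrC ltr_pM2l// ltr_nat.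
set V := a u ^+ 2 * (t - u).
have V0 : 0 <= V by rewrite mulr_ge0 ?sqr_ge0// subr_ge0 ltW.
pose X (e : 'I_N * 'I_N) om : R := if 0 < A e.1 e.2
  then `|A e.1 e.2 * sigma e.2 e.1| * `|I e.2 e.1 t om - I e.2 e.1 u om| else 0.
have mI e : 0 < A e.1 e.2 -> measurable_fun setT (fun om => `|I e.2 e.1 t om - I e.2 e.1 u om|).
  move=> Ae; apply: measurableT_comp => //.
  by apply: measurable_funB; [have [] := hI Ae (ltW t0)|have [] := hI Ae u0].
have mX e : measurable_fun setT (X e).
  rewrite /X; have [Ae|_] := boolP (0 < A e.1 e.2) => //.
  by apply: measurable_funM => //; exact: mI.
have X0 e om : 0 <= X e om by rewrite /X; case: ifP => // _; rewrite mulr_ge0.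
have XC e : (moment P (2 * m) (X e) <= (Ce e * V ^+ m)%:E)%E.
  rewrite /X /Ce; have [Ae|_] := boolP (0 < A e.1 e.2); last first.
    by rewrite mul0r (moment_cst P (2 * m) 0) expr0n muln_eq0/= gtn_eqF.
  rewrite -mulrA; apply: momentZ_le => //; first exact: mI.
  rewrite /moment.
  under eq_integral do rewrite exprM real_normK ?num_real// -exprM.
  rewrite -mulrA; have [mw _] := bw.
  apply: (@wiener_increment_moment _ _ _ P a (w e.2 e.1)) => //.
  - by move=> t' /a_gt0/ltW.
  - by move=> t'; exact: mw.
  - by move=> m' s' s0 ss C mC; exact: (brownian_increments bw Ae).
  - exact: a_gt0.
  - exact: hI (ltW t0).
  - exact: hI u0.
apply: (@le_trans _ _ (moment P (2 * m) (fun om => \sum_(e <- s) X e om))).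
  apply: le_moment => //.
  - exact: measurable_noise_increment (ltW t0) u0.
  - exact: measurable_sum.
  - by move=> om; exact: noise_increment_ge0.
  move=> om; rewrite /s -(pair_bigA _ (fun i j => X (i, j) om))/=.
  apply: ler_sum => i _; rewrite /edge_noise -sumrB.
  apply: le_trans (ler_norm_sum _ _ _) _; rewrite big_mkcond /=.
  by apply: ler_sum => j _; rewrite /X/=; case: ifP => // _; rewrite -mulrBr normrM.
have := @moment_sum_le _ _ _ P (2 * m)%N _ s X (fun e => Ce e * V ^+ m) _ mX X0 _ XC.
move=> /(_ _ _)/le_trans; apply.
- by rewrite muln_gt0.
- by move=> e; rewrite mulr_ge0// exprn_ge0.
by rewrite -mulr_suml mulrA.
Qed.

(** Countably many times share one null set. *)
Lemma ae_path_eqn_grid (u : nat -> nat -> R) : (forall n k, 0 <= u n k) ->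
  {ae P, forall om, (forall n k, path_eqn a (laplacian A) (fun i t => x i t om)
     (fun i t => xt i t om) (fun i t => edge_noise i t om) (u n k)) /\
     forall i, {within `[0, +oo[, continuous (fun t => x i t om)}}.
Proof.
move=> u0.
have h1 : {ae P, forall om, forall n k, path_eqn a (laplacian A) (fun i t => x i t om)
     (fun i t => xt i t om) (fun i t => edge_noise i t om) (u n k)}.
  by apply: ae_foralln => n; apply: ae_foralln => k; exact: ito (u0 n k).
have h2 : {ae P, forall om, forall i, {within `[0, +oo[, continuous (fun t => x i t om)}}.
  exact: filter_forall.
by apply: filterS2 h1 h2.
Qed.

(* The start time is 0 or t / 2 (c = 0, 1), so that all grid points are rational
   multiples of t, as wiener_increment_moment requires. *)
Lemma disagreement_moment_step m : (0 < m)%N -> exists lam C, [/\ 0 < lam, 0 <= C &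
  forall (c : nat) t g, (c < 2)%N -> 0 < t -> 0 <= g ->
  (moment P (2 * m) (disagreement (c%:R * t / 2)) <= g%:E)%E ->
  (moment P (2 * m) (disagreement t) <=
   (C * (expR (- (lam * a t * (t - c%:R * t / 2))) *
           (g + (a (c%:R * t / 2)%R ^+ 2 * (t - c%:R * t / 2)) ^+ m)
         + a (c%:R * t / 2)%R ^+ m
         + (a (c%:R * t / 2)%R ^+ 2 * (t - c%:R * t / 2)) ^+ m))%:E)%E].
Proof.
move=> m0; have [Cn Cn0 noiseC] := noise_increment_moment m0.
have [Ad A0] := adjA.
have [nu [lam [h [K [[lam0 h0 K0 lamh] [nu0 nuD spread_nu nu_spread nuL]]]]]] :=
  consensus_seminorm Ad A0 treeA (erefl (laplacian A)).
pose D := drift_const (laplacian A) K / lam.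
have D0 : 0 <= D.
  rewrite /D mulr_ge0 ?invr_ge0 ?(ltW lam0)// /drift_const mulr_ge0 ?(ltW K0)//.
  rewrite mulr_ge0 ?exprn_ge0// mulr_ge0// sumr_ge0// => i _; exact: sumr_ge0.
(* A vector with entries bounded by [c] in absolute value has [spread] at most [N2 * c]. *)
pose N2 : R := N%:R ^+ 2 * 2.
have N20 : 0 <= N2 by rewrite mulr_ge0// exprn_ge0.
pose q := (2 * m)%N.
pose C1 := K ^+ q * (2 ^+ q * (1 + N2 ^+ q * Cn)).
pose C2 := D ^+ q * (2 ^+ q * (1 + Cn)).
have C10 : 0 <= C1.
  by rewrite /C1 !mulr_ge0 ?exprn_ge0 ?(ltW K0)// addr_ge0// mulr_ge0// exprn_ge0.
have C20 : 0 <= C2 by rewrite /C2 !mulr_ge0 ?exprn_ge0// addr_ge0.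
exists lam, ((2 * K) ^+ q * (C1 + C2)); split=> //.
  by rewrite mulr_ge0 ?exprn_ge0 ?addr_ge0// mulr_ge0// ltW.
move=> c t g c2 t0 g0; set s := c%:R * t / 2 => gs.
have c2R : c%:R < 2 :> R by rewrite ltr_nat.
have s0 : 0 <= s by rewrite !mulr_ge0// ?ltW// invr_gt0.
have st : s < t by rewrite /s ltr_pdivrMr// mulrC ltr_pM2l.
set V := (a s ^+ 2 * (t - s)) ^+ m.
have V0 : 0 <= V by rewrite exprn_ge0// mulr_ge0 ?sqr_ge0// subr_ge0 ltW.
(* From [n0] cells on, a step is short enough for the contraction, which requires gain integrals at
   most [h]. *)
have [n0 n0P] : exists n0 : nat, a s * (t - s) / h <= n0%:R.
  exists (Num.truncn (a s * (t - s) / h)).+1; exact/ltW/truncnS_gt.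
pose nn l := (n0 + l).+1.
have nnR l : 0 < (nn l)%:R :> R by rewrite ltr0n.
pose tau l := (t - s) / (nn l)%:R.
have tau0 l : 0 < tau l by rewrite divr_gt0// subr_gt0.
pose u l (k : nat) := s + k%:R * tau l.
have u0 l k : 0 <= u l k by rewrite addr_ge0// mulr_ge0// ltW.
have us l k : s <= u l k by rewrite lerDl mulr_ge0// ltW.
have uS l k : u l k.+1 - u l k = tau l by rewrite /u -natr1; ring.
have u00 l : u l 0%N = s by rewrite /u mul0r addr0.
have un l : u l (nn l) = t by rewrite /u /tau mulrC divfK ?gt_eqF// addrC subrK.
have ut l k : (k <= nn l)%N -> u l k <= t.
  by move=> kn; rewrite -(un l) /u lerD2l ler_pM2r// ler_nat.
have urat l k : u l k = (c * nn l + k * (2 - c))%:R * t / (2 * nn l)%:R.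
  rewrite natrD !natrM natrB ?(ltnW c2)// /u /tau /s; field.
  by rewrite gt_eqF.
have tauh l : a s * tau l <= h.
  rewrite /tau mulrA ler_pdivrMr//; move: n0P; rewrite ler_pdivrMr// => /le_trans; apply.
  by rewrite [leRHS]mulrC ler_pM2r// ler_nat /nn -addnS leq_addr.
pose th l k := lam * gain_integral a (u l k) (u l k.+1).
pose cc l k om := D * (Num.sqrt (a s) + noise_increment t (u l k) om).
pose z0 om := K * (disagreement s om + N2 * noise_increment t s om).
pose r l := lam * (a t * tau l).
have rth l k : (k < nn l)%N -> r l <= th l k <= 1.
  move=> kn.
  have uu : u l k <= u l k.+1 by rewrite -subr_ge0 uS ltW.
  have /andP[b1 b2] := gain_integralP a_gt0 a_dec (u0 l k) uu.
  rewrite uS in b1 b2; apply/andP; split.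
    rewrite /r /th ler_wpM2l ?(ltW lam0)//; apply: le_trans b1.
    by rewrite ler_wpM2r ?(ltW (tau0 l))// a_dec// ut.
  apply: le_trans lamh; rewrite /th ler_wpM2l ?(ltW lam0)//; apply: (le_trans b2).
  by apply: le_trans (tauh l); rewrite ler_wpM2r ?(ltW (tau0 l))// a_dec.
have r01 l : 0 <= r l <= 1.
  have /andP[h1 h2] := rth l 0%N isT; rewrite (le_trans h1 h2) andbT.
  by rewrite /r mulr_ge0 ?(ltW lam0)// mulr_ge0 ?(ltW (tau0 l))// ltW// a_gt0// ltW.
have mnoise l k : measurable_fun setT (noise_increment t (u l k)).
  exact: measurable_noise_increment (ltW t0) (u0 l k).
have mnoises : measurable_fun setT (noise_increment t s).
  exact: measurable_noise_increment (ltW t0) s0.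
have sqa : Num.sqrt (a s) ^+ q = a s ^+ m.
  by rewrite exprM sqr_sqrtr// ltW// a_gt0.
have noiseV l k : (k < nn l)%N -> (moment P q (noise_increment t (u l k)) <= (Cn * V)%:E)%E.
  move=> kn; have pq : (c * nn l + k * (2 - c) < 2 * nn l)%N.
    have -> : (2 * nn l = c * nn l + nn l * (2 - c))%N.
      by rewrite [(nn l * _)%N]mulnC -mulnDl subnKC// ltnW.
    by rewrite ltn_add2l ltn_pmul2r// subn_gt0.
  rewrite urat; apply: le_trans (noiseC t _ _ t0 pq) _.
  have aus : a (u l k) ^+ 2 <= a s ^+ 2.
    by rewrite lerXn2r ?nnegrE ?a_dec// ltW// a_gt0.
  have tu : 0 <= t - u l k by rewrite subr_ge0 ut// ltnW.
  have uV0 : 0 <= a (u l k) ^+ 2 * (t - u l k) by rewrite mulr_ge0 ?sqr_ge0.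
  have uV : a (u l k) ^+ 2 * (t - u l k) <= a s ^+ 2 * (t - s).
    by apply: ler_pM; rewrite ?sqr_ge0// lerD2l lerN2.
  by rewrite lee_fin ler_wpM2l// -urat lerXn2r ?nnegrE// (le_trans uV0).
have noisesV : (moment P q (noise_increment t s) <= (Cn * V)%:E)%E.
  by have := noiseV 0%N 0%N isT; rewrite u00.
have z0C : (moment P q z0 <= (C1 * (g + V))%:E)%E.
  apply: (@le_trans _ _ (K ^+ q * (2 ^+ q * (g + N2 ^+ q * (Cn * V))))%:E).
    apply: momentZ_le; rewrite ?(ltW K0)//.
    - by apply: measurable_funD; [exact: measurable_disagreement|exact: measurable_funM].
    - by move=> om; rewrite addr_ge0 ?spread_ge0// mulr_ge0// noise_increment_ge0.
    apply: momentD_le => //.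
    - exact: measurable_disagreement.
    - exact: measurable_funM.
    - by move=> om; exact: spread_ge0.
    - by move=> om; rewrite mulr_ge0// noise_increment_ge0.
    - by apply: momentZ_le => // om; exact: noise_increment_ge0.
  rewrite lee_fin /C1 -!mulrA ler_wpM2l ?exprn_ge0 ?(ltW K0)// ler_wpM2l ?exprn_ge0//.
  have NC : 0 <= N2 ^+ q * Cn by rewrite mulr_ge0// exprn_ge0.
  by have := mulr_ge0 NC g0; rewrite mulrA; nra.
have ccC l k : (k < nn l)%N -> (moment P q (cc l k) <= (C2 * (a s ^+ m + V))%:E)%E.
  move=> kn; apply: (@le_trans _ _ (D ^+ q * (2 ^+ q * (a s ^+ m + Cn * V)))%:E).
    apply: momentZ_le => //.
    - exact: measurable_funD.
    - by move=> om; rewrite addr_ge0 ?sqrtr_ge0// noise_increment_ge0.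
    apply: momentD_le => //.
    - by move=> om; exact: noise_increment_ge0.
    - by rewrite -sqa moment_cst.
    - exact: noiseV.
  rewrite lee_fin /C2 -!mulrA ler_wpM2l ?exprn_ge0// ler_wpM2l ?exprn_ge0//.
  have am0 : 0 <= a s ^+ m by rewrite exprn_ge0// ltW// a_gt0.
  by have := mulr_ge0 Cn0 am0; nra.
have am0 : 0 <= a s ^+ m by rewrite exprn_ge0// ltW// a_gt0.
pose Z l om := convex_majorant (th l) ((cc l)^~ om) (z0 om) (nn l).
have ZP l : [/\ measurable_fun setT (Z l), forall om, 0 <= Z l om &
    (moment P q (Z l) <= ((1 - r l) ^+ nn l * (C1 * (g + V)) + C2 * (a s ^+ m + V))%:E)%E].
  apply: convex_majorant_moment => //.
  - by rewrite mulr_ge0// addr_ge0.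
  - by rewrite mulr_ge0// addr_ge0.
  - exact: rth.
  - by move=> k _; apply: measurable_funM => //; exact: measurable_funD.
  - by move=> k om; rewrite mulr_ge0// addr_ge0 ?sqrtr_ge0// noise_increment_ge0.
  - apply: measurable_funM => //; apply: measurable_funD; first exact: measurable_disagreement.
    exact: measurable_funM.
  - by move=> om; rewrite mulr_ge0 ?(ltW K0)// addr_ge0 ?spread_ge0// mulr_ge0// noise_increment_ge0.
  - exact: ccC.
have Zexp l : (moment P q (Z l) <= ((C1 + C2) *
    (expR (- (lam * a t * (t - s))) * (g + V) + a s ^+ m + V))%:E)%E.
  have [_ _ /le_trans] := ZP l; apply; rewrite lee_fin.
  (* [1 - r <= exp (- r)], and the [nn l] steps of length [tau l] add up to [t - s]. *)
  have rexp : (1 - r l) ^+ nn l <= expR (- (lam * a t * (t - s))).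
    apply: (@le_trans _ _ (expR (- r l) ^+ nn l)).
      rewrite lerXn2r ?nnegrE ?expR_ge0//; first by rewrite subr_ge0; case/andP: (r01 l).
      exact: expR_ge1Dx.
    rewrite -expRM_natl ler_expR /r /tau mulrN lerN2 le_eqVlt; apply/orP; left; apply/eqP.
    by field; rewrite gt_eqF.
  set E := expR _ in rexp *; have gV : 0 <= g + V by rewrite addr_ge0.
  have E0 : 0 <= E by exact: expR_ge0.
  have h1 : (1 - r l) ^+ nn l * (C1 * (g + V)) <= E * (C1 * (g + V)).
    by rewrite ler_wpM2r// mulr_ge0.
  apply: (le_trans (lerD h1 (lexx _))).
  have h2 : 0 <= C1 * (a s ^+ m + V) by rewrite mulr_ge0// addr_ge0.
  have h3 : 0 <= C2 * (E * (g + V)) by rewrite mulr_ge0// mulr_ge0.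
  move: h2 h3; set X := a s ^+ m; rewrite !mulrDr !mulrDl; lra.
have ugrid := @ae_path_eqn_grid u u0.
apply: (@fatou_le _ _ _ P (fun om => (disagreement t om ^+ q)%:E)
  (fun l om => ((2 * K * Z l om) ^+ q)%:E)).
- by apply/measurable_EFinP; apply: measurable_funX; exact: measurable_disagreement.
- move=> l; apply/measurable_EFinP; apply: measurable_funX; apply: measurable_funM => //.
  by have [] := ZP l.
- by move=> om; rewrite lee_fin exprn_ge0// spread_ge0.
- move=> l om; rewrite lee_fin exprn_ge0// mulr_ge0 ?mulr_ge0// ?(ltW K0)//.
  by have [] := ZP l.
- apply: filterS ugrid => om [equ cont].
  have [x0|x0] := eqVneq (disagreement t om) 0.
    apply: nearW => l; rewrite x0 lee_fin expr0n muln_eq0/= gtn_eqF//= exprn_ge0//.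
    by rewrite mulr_ge0 ?mulr_ge0// ?(ltW K0)//; have [] := ZP l.
  have xt0 : 0 < disagreement t om by rewrite lt_neqAle eq_sym x0 spread_ge0.
  (* The tolerance depends on the path: [K * (D * e)] is at most half of the disagreement and is
     absorbed by it, which doubles [K * Z l om]. [D + 1] covers the case [D = 0]. *)
  pose e := disagreement t om / (2 * K * (D + 1)).
  have e0 : 0 < e by rewrite divr_gt0// !mulr_gt0// ltr_wpDl.
  (* Eventually the mesh [tau l] is below the modulus of continuity of this path. *)
  have osc : \forall l \near \oo, forall i k v, (k < nn l)%N ->
      u l k <= v <= u l k.+1 -> `|x i v om - x i (u l k) om| <= e.
    apply: filter_forall => i.
    have [de de0 deP] := path_unif_continuous (cont i) t e0.
    exists (Num.truncn ((t - s) / de)).+1 => // l /= ln k v kn /andP[uv vu].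
    apply/ltW/deP; first exact: le_trans (u0 l k) uv.
      by rewrite u0 ut// ltnW.
    rewrite ger0_norm ?subr_ge0// (@le_lt_trans _ _ (tau l))//.
      by rewrite -(uS l k) lerD2r.
    rewrite /tau ltr_pdivrMr// mulrC -ltr_pdivrMr//.
    apply: lt_le_trans (truncnS_gt _) _; rewrite ler_nat (leq_trans ln)//.
    by rewrite /nn -addSn leq_addl.
  apply: filterS osc => l oscl.
  have := @path_grid_bound R N a (laplacian A) (fun i t => x i t om) (fun i t => xt i t om)
    (fun i t => edge_noise i t om) a_gt0 a_dec cont (fun i => @hx i om) nu lam h K (ltW K0)
    nuD nu_spread nuL lam0 lamh (u l) (nn l) t e (z0 om) (ltW e0).
  rewrite u00 un => /(_ s0 (fun k _ => equ l k)) path.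
  have uu k : (k < nn l)%N -> u l k <= u l k.+1 by rewrite -subr_ge0 uS ltW.
  have uh k : (k < nn l)%N -> a s * (u l k.+1 - u l k) <= h by rewrite uS.
  have {}path := path uu uh (fun i k v kn => oscl i k v kn).
  set sp := shifted_path _ _ _ in path.
  have zs : nu (sp s) <= z0 om.
    apply: le_trans (nu_spread _) _; rewrite ler_wpM2l ?(ltW K0)//.
    have -> : sp s = \col_i x i s om + \col_i (edge_noise i t om - edge_noise i s om).
      by apply/colP => i; rewrite !mxE addrA.
    apply: le_trans (spreadD _ _) _; rewrite lerD2l /N2 -mulrA.
    apply: spread_le => i j; rewrite !mxE.
    have ni i' : `|edge_noise i' t om - edge_noise i' s om| <= noise_increment t s om.
      by rewrite /noise_increment [leRHS](bigD1 i')//= lerDl sumr_ge0.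
    have := ni i; have := ni j; rewrite !ler_norml => /andP[? ?] /andP[? ?]; lra.
  have {path zs} path := path zs.
  have spt : sp t = \col_i x i t om by apply/colP => i; rewrite !mxE addrK.
  rewrite spt in path.
  have dZ : disagreement t om <= K * (Z l om + D * e).
    by apply: le_trans (spread_nu _) _; rewrite ler_wpM2l ?(ltW K0).
  have De : K * (D * e) <= disagreement t om / 2.
    have -> : disagreement t om = e * (2 * K * (D + 1)).
      by rewrite /e divfK// gt_eqF// !mulr_gt0// ltr_wpDl.
    have : 0 <= K * e by rewrite mulr_ge0 ?(ltW K0)// ltW.
    nra.
  rewrite lee_fin lerXn2r ?nnegrE ?(ltW xt0)//.
    by rewrite mulr_ge0 ?mulr_ge0// ?(ltW K0)//; have [] := ZP l.
  by move: dZ De; rewrite mulrDr; lra.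
- apply: nearW => l.
  have [mZ Z0 _] := ZP l.
  have := @momentZ_le _ _ _ P q (2 * K) (Z l) _ _ mZ Z0 (Zexp l).
  rewrite -!mulrA; apply.
  by rewrite mulr_ge0// ltW.
Qed.

End closed_loop.

(** * Asymptotics and conclusion *)

Section asymptotics.
Context {R : realType}.

Lemma powRN_cvg0 (b : R) : 0 < b -> t `^ (- b) @[t --> +oo] --> 0.
Proof.
move=> b0; apply/cvgr0Pnorm_lt => e e0; near=> t.
have ei0 : 0 < e^-1 by rewrite invr_gt0.
have t0 : 0 < t by near: t; exact: nbhs_pinfty_gt.
rewrite ger0_norm ?powR_ge0// powRN -[ltRHS]invrK ltf_pV2 ?posrE ?powR_gt0//.
have -> : e^-1 = ((e^-1) `^ b^-1) `^ b by rewrite -powRrM mulVf ?gt_eqF// powRr1// ltW.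
by rewrite gt0_ltr_powR ?nnegrE ?powR_ge0 ?(ltW t0).
Unshelve. all: by end_near. Qed.

Lemma cvg_half (f : R -> R) (l : R) : f t @[t --> +oo] --> l ->
  f (t / 2) @[t --> +oo] --> l.
Proof.
move=> fl; apply: (@cvg_comp _ _ _ (fun t : R => t / 2) f _ (+oo)) => //.
apply/cvgryPge => B; near=> t; by rewrite ler_pdivlMr.
Unshelve. all: by end_near. Qed.

Variables (a : R -> R) (gamma c : R).
Hypotheses (gamma_gt : 1 / 2 < gamma) (gamma_lt : gamma < 1) (c_gt0 : 0 < c).
Hypothesis a_cvg : (t `^ gamma * a t) @[t --> +oo] --> c.
Hypothesis a_dec : forall s t, 0 <= s -> s <= t -> a t <= a s.

(** The positive limit makes [a] positive at late times, and monotonicity carries this back to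
    earlier ones. *)
Lemma gain_gt0 t : 0 <= t -> 0 < a t.
Proof.
move=> t0; have : \forall u \near +oo, 0 < u `^ gamma * a u /\ t < u.
  near=> u; split.
    by near: u; exact: (cvgr_gt _ a_cvg).
  by near: u; apply: nbhs_pinfty_gt; rewrite num_real.
move=> /filter_ex[u [ua tu]]; apply: lt_le_trans (a_dec t0 (ltW tu)).
by move: ua; rewrite pmulr_rgt0// powR_gt0// (le_lt_trans t0 tu).
Unshelve. all: by end_near. Qed.

Lemma gain_cvg0 : a t @[t --> +oo] --> 0.
Proof.
have : (t `^ gamma * a t) * t `^ (- gamma) @[t --> +oo] --> c * 0.
  have g0 : 0 < gamma by apply: lt_trans gamma_gt; rewrite divr_gt0.
  by apply: cvgM => //; exact: powRN_cvg0.
rewrite mulr0; apply: cvg_trans; apply: near_eq_cvg; near=> t.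
have t0 : 0 < t by near: t; exact: nbhs_pinfty_gt.
have tn (r s : R) : (r + s == 0) ==> (t != 0) by rewrite (gt_eqF t0) implybT.
by rewrite mulrAC -powRD// subrr powRr0 mul1r.
Unshelve. all: by end_near. Qed.

(** The function is [(t ^ gamma * a t) ^ 2] times [t ^ (1 - 2 gamma)], whose exponent is negative
    because [gamma > 1/2]. *)
Lemma gain_sqr_cvg0 : a t ^+ 2 * t @[t --> +oo] --> 0.
Proof.
have : (t `^ gamma * a t) * (t `^ gamma * a t) * t `^ (- (2 * gamma - 1)) @[t --> +oo] --> c * c * 0.
  have g0 : 0 < 2 * gamma - 1 by rewrite subr_gt0 mulrC -ltr_pdivrMr.
  by apply: cvgM; [exact: cvgM|exact: powRN_cvg0].
rewrite mulr0; apply: cvg_trans; apply: near_eq_cvg; near=> t.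
have t0 : 0 < t by near: t; exact: nbhs_pinfty_gt.
have tn (r s : R) : (r + s == 0) ==> (t != 0) by rewrite (gt_eqF t0) implybT.
rewrite mulrACA -powRD// mulrAC -powRD// expr2 mulrC; congr (_ * _).
rewrite (_ : gamma + gamma + _ = 1) ?powRr1 ?ltW//; ring.
Unshelve. all: by end_near. Qed.

Lemma gain_exp_decay lam m : 0 < lam ->
  expR (- (lam * a t * (t / 2))) * t ^+ m @[t --> +oo] --> 0.
Proof.
(* [n (1 - gamma) >= m + 1], so the bound [n! / y ^ n] on [exp (- y)] beats [t ^+ m] with a factor
   [1 / t] to spare. *)
move=> lam0; pose n := (Num.truncn ((m.+1)%:R / (1 - gamma))).+1.
have g1 : 0 < 1 - gamma by rewrite subr_gt0.
have nP : (m.+1)%:R <= (1 - gamma) * n%:R.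
  by rewrite mulrC -ler_pdivrMr// ltW// truncnS_gt.
(* One factor 1/2 comes from [t / 2], the other from [t ^ gamma * a t > c / 2] for large [t]. *)
pose k := lam * c / 4.
have k0 : 0 < k by rewrite divr_gt0// mulr_gt0.
have kn0 : 0 < k ^+ n by rewrite exprn_gt0.
have K0 : n`!%:R / k ^+ n * t `^ (- 1) @[t --> +oo] --> (n`!%:R / k ^+ n * 0 : R).
  by apply: cvgM; [exact: cvg_cst|exact: powRN_cvg0].
rewrite mulr0 in K0; apply: (squeeze_cvgr _ (cvg_cst 0) K0).
near=> t; have t1 : 1 <= t by near: t; exact: nbhs_pinfty_ge.
have t0 : 0 < t by rewrite (lt_le_trans _ t1).
rewrite mulr_ge0 ?expR_ge0 ?exprn_ge0 ?(ltW t0)//=.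
set y := lam * a t * (t / 2).
have ac : c / 2 < t `^ gamma * a t.
  by near: t; apply: (cvgr_gt _ a_cvg); rewrite ltr_pdivrMr// ltr_pMr// ltr1n.
have yk : k * t `^ (1 - gamma) <= y.
  have E : t = t `^ gamma * t `^ (1 - gamma).
    by rewrite -powRD ?(gt_eqF t0) ?implybT// addrC subrK powRr1// ltW.
  rewrite /y /k; have -> : lam * a t * (t / 2) =
      (lam / 2 * (t `^ gamma * a t)) * t `^ (1 - gamma).
    transitivity (lam * a t * ((t `^ gamma * t `^ (1 - gamma)) / 2)); last by ring.
    by rewrite -E.
  rewrite ler_wpM2r ?powR_ge0//.
  rewrite (_ : lam * c / 4 = lam / 2 * (c / 2)); last by field.
  by rewrite ler_wpM2l ?ltW// divr_gt0.
have kt0 : 0 <= k * t `^ (1 - gamma) by rewrite mulr_ge0 ?powR_ge0 ?(ltW k0).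
have y0 := le_trans kt0 yk.
have kt : k ^+ n * t ^+ m.+1 <= y ^+ n.
  apply: (@le_trans _ _ ((k * t `^ (1 - gamma)) ^+ n)); last by rewrite lerXn2r ?nnegrE.
  rewrite [leRHS]exprMn; apply: ler_wpM2l; first exact: ltW.
  rewrite -[leRHS]powR_mulrn ?powR_ge0// -powRrM -powR_mulrn ?(ltW t0)//.
  exact: ler_powR.
have := le_trans kt (exprn_le_expR n y0).
rewrite powR_inv1 ?(ltW t0)// -(ler_pM2r (expR_gt0 (- y))) -[leRHS]mulrA -expRD subrr expR0 mulr1 => H.
rewrite ler_pdivlMr// ler_pdivlMr// (le_trans _ H)// exprS le_eqVlt.
by apply/orP; left; apply/eqP; ring.
Unshelve. all: by end_near. Qed.

Lemma disagreement_bound_cvg0 (lam C g0 a0 : R) m : 0 < lam -> (0 < m)%N ->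
  C * (expR (- (lam * a t * (t / 2))) *
         (C * (g0 + (a0 ^+ 2 * (t / 2)) ^+ m + a0 ^+ m + (a0 ^+ 2 * (t / 2)) ^+ m)
          + (a (t / 2) ^+ 2 * (t / 2)) ^+ m)
       + a (t / 2) ^+ m + (a (t / 2) ^+ 2 * (t / 2)) ^+ m) @[t --> +oo] --> (0 : R).
Proof.
move=> lam0 m0.
have pow0 (f : R -> R) : f t @[t --> +oo] --> 0 -> f t ^+ m @[t --> +oo] --> 0.
  move=> /(@cvg_comp _ _ _ f (fun y => y ^+ m) _ _ _)/(_ (@exprn_continuous _ m 0)).
  by rewrite expr0n gtn_eqF.
have A0 := pow0 _ (cvg_half gain_cvg0).
have V0 := pow0 _ (cvg_half gain_sqr_cvg0).
have E0 : expR (- (lam * a t * (t / 2))) @[t --> +oo] --> (0 : R).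
  by apply: cvg_trans (gain_exp_decay 0 lam0); apply: near_eq_cvg; near=> t; rewrite expr0 mulr1.
have Em := gain_exp_decay m lam0.
(* The growth of the a priori bound is isolated as [k2 * t ^+ m], to be set against the
   exponential. *)
pose k1 := C * (g0 + a0 ^+ m); pose k2 := C * 2 * (a0 ^+ 2 / 2) ^+ m.
have L : C * (expR (- (lam * a t * (t / 2))) * k1 +
    k2 * (expR (- (lam * a t * (t / 2))) * t ^+ m) +
    expR (- (lam * a t * (t / 2))) * (a (t / 2) ^+ 2 * (t / 2)) ^+ m
    + a (t / 2) ^+ m + (a (t / 2) ^+ 2 * (t / 2)) ^+ m) @[t --> +oo] -->
    C * (0 * k1 + k2 * 0 + 0 * 0 + 0 + 0).
  apply: cvgM; first exact: cvg_cst.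
  apply: cvgD => //; apply: cvgD => //; apply: cvgD; last exact: cvgM.
  by apply: cvgD; apply: cvgM => //; exact: cvg_cst.
rewrite !(mul0r, mulr0, addr0) in L; apply: cvg_trans L; apply: near_eq_cvg; near=> t.
rewrite /k1 /k2 (_ : a0 ^+ 2 * (t / 2) = a0 ^+ 2 / 2 * t); last by ring.
by rewrite [(a0 ^+ 2 / 2 * t) ^+ m]exprMn; ring.
Unshelve. all: by end_near. Qed.

End asymptotics.

(** Recovers a real exponent from an even one. With [b] such that [b ^ p = e], a power of [y / b] is
    at most 1 below [b] and increases with the exponent above [b]. *)
Lemma powR_le_affine {R : realType} (p e : R) m : 0 < p -> p <= (2 * m)%:R -> 0 < e ->
  exists2 K, 0 < K & forall y : R, 0 <= y -> y `^ p <= e + K * y ^+ (2 * m).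
Proof.
move=> p0 pm e0; pose b := e `^ p^-1.
have b0 : 0 < b by rewrite powR_gt0.
have bp : b `^ p = e by rewrite /b -powRrM mulVf ?gt_eqF// powRr1// ltW.
exists (e / b ^+ (2 * m)); first by rewrite divr_gt0// exprn_gt0.
move=> y y0; have yb : 0 <= y / b by rewrite divr_ge0// ltW.
have -> : y `^ p = e * (y / b) `^ p.
  by rewrite -bp -powRM ?(ltW b0)// mulrC divfK// gt_eqF.
have -> : e / b ^+ (2 * m) * y ^+ (2 * m) = e * (y / b) ^+ (2 * m).
  by rewrite exprMn exprVn mulrAC mulrA.
rewrite -[X in X + _]mulr1 -mulrDr ler_wpM2l ?(ltW e0)//.
have [y1|/ltW y1] := leP (y / b) 1.
  apply: (@le_trans _ _ 1); last by rewrite lerDl exprn_ge0.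
  apply: (@le_trans _ _ (1 `^ p)); last by rewrite powR1.
  by rewrite ge0_ler_powR ?nnegrE ?(ltW p0).
by rewrite -powR_mulrn// (le_trans (ler_powR y1 pm))// lerDr.
Qed.

Lemma cvge0_le {R : realType} (f : R -> \bar R) : (forall t, (0 <= f t)%E) ->
  (forall e : R, 0 < e -> \forall t \near +oo, (f t <= e%:E)%E) ->
  f t @[t --> +oo] --> 0%E.
Proof.
move=> f0 fe.
have fin e t : (f t <= e%:E)%E -> f t \is a fin_num.
  by move=> ft; rewrite ge0_fin_numE// (le_lt_trans ft)// ltry.
apply/fine_cvgP; split; first by apply: filterS (fe 1 ltr01) => t; exact: fin.
apply/cvgr0Pnorm_le => e e0; apply: filterS (fe e e0) => t fte /=.
by rewrite ger0_norm ?fine_ge0// -lee_fin fineK// (fin _ _ fte).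
Qed.

Theorem theorem1 (d : measure_display) (T : measurableType d) (R : realType)
  (P : probability T R) (N : nat) (A : 'M[R]_N) (sigma : 'I_N -> 'I_N -> R)
  (a : R -> R) (gamma : R)
  (w : 'I_N -> 'I_N -> R -> T -> R)
  (x xt : 'I_N -> R -> T -> R)
  (I : 'I_N -> 'I_N -> R -> T -> R) :
  is_adjacency A ->
  has_spanning_tree A ->
  1 / 2 < gamma -> gamma < 1 ->
  gain_assumptions a gamma ->
  (forall j i, 0 < A i j -> 0 < sigma j i) ->
  brownian_family P A (fun i => x i 0) w ->
  (* states are random variables with (a.s.) continuous paths *)
  (forall i t, measurable_fun setT (x i t)) ->
  (forall i, {ae P, forall om, {within `[0, +oo[, continuous (fun t => x i t om)}}) ->
  (* initial states have finite moments of every order *)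
  (forall i (p : R), 0 <= p -> (\int[P]_om ((`|x i 0 om|) `^ p)%:E < +oo)%E) ->
  (* event-triggered broadcast states *)
  (forall i om, held_state a (fun t => x i t om) (fun t => xt i t om)) ->
  (* Ito integrals int_0^t a(s) dw_ji(s) *)
  (forall j i t, 0 < A i j -> 0 <= t -> is_wiener_integral P a (w j i) t (I j i t)) ->
  (* the closed-loop Ito equation in integral form *)
  (forall i t, 0 <= t -> {ae P, forall om,
      (x i t om)%:E =
        ((x i 0 om)%:E
         - \int[lebesgue_measure]_(s in `[0%R, t]%classic)
              (a s * \sum_(j < N) laplacian A i j * xt j s om)%:E
         + (\sum_(j < N | 0 < A i j) A i j * sigma j i * I j i t om)%:E)%E}) ->
  forall p : R, 2 <= p -> forall i j : 'I_N,
    (\int[P]_om ((`|x j t om - x i t om|) `^ p)%:E)%E @[t --> +oo] --> 0%E.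
Proof.
move=> adjA treeA gamma_gt gamma_lt [a0 [a_dec [_ [_ [c [c_gt0 a_cvg]]]]]] _ bw mx cx ix hx hI ito p p2 i j.
have a_gt0 := gain_gt0 c_gt0 a_cvg a_dec.
have ito' t : 0 <= t -> {ae P, forall om,
    path_eqn a (laplacian A) (fun i t => x i t om) (fun i t => xt i t om)
      (fun i t => edge_noise A sigma I i t om) t}.
  by move=> t0; apply: filter_forall => k; exact: ito.
pose m := (Num.truncn p).+1.
have p0 : 0 < p by rewrite (lt_le_trans _ p2).
have pm : p <= (2 * m)%:R.
  by rewrite (le_trans (ltW (truncnS_gt p)))// ler_nat leq_pmull.
have [lam [C [lam0 C0 step]]] := @disagreement_moment_step _ _ _ P _ A sigma a w x xt I
  adjA treeA a_gt0 a_dec bw mx cx hx hI ito' m isT.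
pose S t := moment P (2 * m) (disagreement x t).
have [g0 g00 S0] : exists2 g0, 0 <= g0 & (S 0%R <= g0%:E)%E.
  pose X0 k om := `|x k 0 om|.
  have X00 k om : 0 <= X0 k om by exact: normr_ge0.
  have mom k : exists2 g, 0 <= g & (moment P (2 * m) (X0 k) <= g%:E)%E.
    exists (fine (moment P (2 * m) (X0 k))).
      by rewrite fine_ge0//; exact: moment_ge0.
    rewrite fineK// ge0_fin_numE; last exact: moment_ge0.
    have := ix k (2 * m)%:R (ler0n _ _).
    by under eq_integral do rewrite powR_mulrn//.
  pose G k := s2val (cid2 (mom k)).
  have G0 k : 0 <= G k by rewrite /G; case: cid2.
  have GP k : (moment P (2 * m) (X0 k) <= (G k)%:E)%E by rewrite /G; case: cid2.
  have mabs k : measurable_fun setT (X0 k) by exact: measurableT_comp.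
  have := @moment_sum_le _ _ _ P (2 * m)%N _ (index_enum 'I_N) X0 G
    isT mabs X00 G0 GP.
  set g1 := _ * _ => g1P.
  exists ((N%:R ^+ 2 * 2) ^+ (2 * m) * g1).
    by rewrite mulr_ge0 ?exprn_ge0 ?mulr_ge0 ?exprn_ge0 ?sumr_ge0.
  apply: le_trans (momentZ_le _ _ _ g1P); last 3 first.
  - by rewrite mulr_ge0// exprn_ge0.
  - exact: measurable_sum.
  - by move=> om; apply: sumr_ge0.
  apply: le_moment.
  - exact: measurable_disagreement.
  - by apply: measurable_funM => //; exact: measurable_sum.
  - by move=> om; exact: spread_ge0.
  move=> om; rewrite -mulrA; apply: spread_le => k l; rewrite !mxE.
  have nx k' : `|x k' 0 om| <= \sum_k `|x k 0 om|.
    by rewrite [leRHS](bigD1 k')//= lerDl sumr_ge0.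
  by have := nx k; have := nx l; rewrite !ler_norml => /andP[? ?] /andP[? ?]; lra.
(* Start at 0: the exponential is merely bounded by 1. *)
have S1 t : 0 < t -> (S t <= (C * (g0 + (a 0 ^+ 2 * t) ^+ m + a 0 ^+ m + (a 0 ^+ 2 * t) ^+ m))%:E)%E.
  move=> t0; have := step 0%N t g0 isT t0 g00; rewrite !mul0r subr0 => /(_ S0) /le_trans; apply.
  have V0 : 0 <= (a 0 ^+ 2 * t) ^+ m by rewrite exprn_ge0// mulr_ge0 ?sqr_ge0// ltW.
  rewrite lee_fin ler_wpM2l// !lerD2r ler_piMl ?addr_ge0//.
  by rewrite -expR0 ler_expR oppr_le0 !mulr_ge0// ?a0// ltW.
(* Start at [t / 2], where the preceding bound serves as initial moment. *)
have S2 t : 0 < t -> (S t <= (C * (expR (- (lam * a t * (t / 2))) *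
         (C * (g0 + (a 0 ^+ 2 * (t / 2)) ^+ m + a 0 ^+ m + (a 0 ^+ 2 * (t / 2)) ^+ m)
          + (a (t / 2)%R ^+ 2 * (t / 2)) ^+ m)
       + a (t / 2)%R ^+ m + (a (t / 2)%R ^+ 2 * (t / 2)) ^+ m))%:E)%E.
  move=> t0; have t20 : 0 < t / 2 by rewrite divr_gt0.
  have := step 1%N t (C * (g0 + (a 0 ^+ 2 * (t / 2)) ^+ m + a 0 ^+ m + (a 0 ^+ 2 * (t / 2)) ^+ m)) isT t0.
  rewrite !mul1r (_ : t - t / 2 = t / 2); last by field.
  apply; last exact: S1.
  have V0 : 0 <= (a 0 ^+ 2 * (t / 2)) ^+ m by rewrite exprn_ge0// mulr_ge0 ?sqr_ge0// ltW.
  by rewrite mulr_ge0// !addr_ge0// exprn_ge0// a0.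
apply: cvge0_le => [t|e e0].
  by apply: integral_ge0 => om _; rewrite lee_fin powR_ge0.
(* Half of [e] pays for the additive constant, the other half for [K] times the even moment. *)
have [K K0 pK] := powR_le_affine p0 pm (divr_gt0 e0 (@ltr0n R 2)).
have eK : 0 < e / 2 / K by rewrite !divr_gt0.
have := @disagreement_bound_cvg0 R a gamma c gamma_gt gamma_lt c_gt0 a_cvg lam C g0 (a 0) m lam0 isT.
move=> /cvgr0_norm_lt /(_ _ eK) bnd.
near=> t; have t0 : 0 < t by near: t; exact: nbhs_pinfty_gt.
have Se : (S t <= (e / 2 / K)%:E)%E.
  apply: (le_trans (S2 t t0)); rewrite lee_fin; apply/ltW.
  apply: le_lt_trans (ler_norm _) _; near: t; exact: bnd.
have mS := measurable_disagreement mx t.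
have mSq : measurable_fun setT (fun om => (disagreement x t om ^+ (2 * m))%:E).
  by apply/measurable_EFinP; exact: measurable_funX.
have Sq0 om : 0 <= disagreement x t om ^+ (2 * m) by rewrite exprn_ge0// spread_ge0.
apply: (@le_trans _ _ (\int[P]_om ((e / 2)%:E + K%:E * (disagreement x t om ^+ (2 * m))%:E))%E).
  apply: ge0_le_integral => //.
  - apply/measurable_EFinP; apply: (measurableT_comp (measurable_powR p)).
    by apply: measurableT_comp => //; exact: measurable_funB.
  - by apply: emeasurable_funD => //; exact: measurable_funeM.
  - move=> om _; rewrite -EFinM -EFinD lee_fin; apply: le_trans (pK _ (normr_ge0 _)) _.
    rewrite lerD2l ler_wpM2l ?(ltW K0)// lerXn2r ?nnegrE ?spread_ge0//.
    by have := spread_ub (\col_k x k t om) j i; rewrite !mxE.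
rewrite ge0_integralD//; last 3 first.
- by move=> om _; rewrite lee_fin ltW// divr_gt0.
- by move=> om _; rewrite mule_ge0 ?lee_fin ?(ltW K0).
- exact: measurable_funeM.
rewrite ge0_integralZl_EFin ?(ltW K0)//; last by move=> om _; rewrite lee_fin Sq0.
have := @moment_cst _ _ _ P 1 (e / 2); rewrite /moment expr1 /= => ->.
rewrite [X in (_ <= X%:E)%E](_ : e = e / 2 + K * (e / 2 / K)); last first.
  by field; rewrite gt_eqF.
rewrite EFinD [(K * _)%:E]EFinM; apply: leeD => //.
by rewrite lee_pmul2l.
Unshelve. all: by end_near. Qed.
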